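(* Let $A$ be an $m\times n$ totally unimodular matrix and $\vec b,\vec c\in\mathbb Z^m$, and suppose $\mathcal P(A,\vec b)$ is bounded. Then there is a polynomial $f$ with $\deg f\le n$ such that $N(A,\vec b k+\vec c)=f(k)$ for all sufficiently large integers $k$. If moreover $\dim\mathcal P(A,\vec b)=n$ and no row of $A$ is zero, then $\deg f=n$ and the leading coefficient of $f$ is the volume of $\mathcal P(A,\vec b)$.
   Context: For an $m\times n$ real matrix $A$ and $\vec b\in\mathbb R^m$, $\mathcal P(A,\vec b)=\{\vec x\in\mathbb R^n : A\vec x\le\vec b,\ \vec x\ge 0\}$ (inequalities componentwise), and $N(A,\vec b)$ is the number of points of $\mathbb Z^n$ in $\mathcal P(A,\vec b)$. A matrix is totally unimodular if every square submatrix has determinant $0$, $1$ or $-1$. The dimension of a polytope is the dimension of its affine span. *)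

(* Defs.v *)
From HB Require Import structures.
From mathcomp Require Import all_boot all_order all_algebra.
From mathcomp Require Import finmap.
From mathcomp Require Import all_classical all_reals all_analysis.
Set Implicit Arguments. Unset Strict Implicit. Unset Printing Implicit Defensive.
Import Order.TTheory GRing.Theory Num.Theory.
Local Open Scope classical_set_scope.
Local Open Scope ring_scope.
Local Open Scope fset_scope.

Section Defs.
Variable R : realType.

Definition totally_unimodular (m n : nat) (A : 'M[R]_(m, n)) : Prop :=
  forall (k : nat) (f : 'I_k -> 'I_m) (g : 'I_k -> 'I_n),
    injective f -> injective g ->
    let d := \det (mxsub f g A) in d = 0 \/ d = 1 \/ d = -1.

Definition Ppoly (m n : nat) (A : 'M[R]_(m, n)) (b : 'cV[R]_m) : set 'cV[R]_n :=
  [set x | (forall i, (A *m x) i ord0 <= b i ord0) /\ (forall j, 0 <= x j ord0)].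

Definition int_points (m n : nat) (A : 'M[R]_(m, n)) (b : 'cV[R]_m) : set 'cV[int]_n :=
  [set z | Ppoly A b (map_mx (fun a : int => a%:~R) z)].

Definition Npts (m n : nat) (A : 'M[R]_(m, n)) (b : 'cV[R]_m) : nat :=
  #|` fset_set (int_points A b)|%fset.

(* affine dimension: S nonempty and d is the (maximal) rank of a family of
   difference vectors x - y with x, y in S, i.e. the dimension of the
   direction space of the affine span of S. *)
Definition diff_family (n k : nat) (S : set 'cV[R]_n) (X : 'M[R]_(k, n)) : Prop :=
  forall i, exists x y, S x /\ S y /\ row i X = (x - y)^T.

Definition affine_dim (n : nat) (S : set 'cV[R]_n) (d : nat) : Prop :=
  S !=set0 /\
  (exists k (X : 'M[R]_(k, n)), diff_family S X /\ \rank X = d) /\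
  (forall k (X : 'M[R]_(k, n)), diff_family S X -> (\rank X <= d)%N).

(* n-dimensional Lebesgue volume, as the iterated Lebesgue integral of the
   indicator function (coordinates are indexed by nat; only 0..n-1 matter). *)
Fixpoint iter_int (k : nat) (g : (nat -> R) -> \bar R) : (nat -> R) -> \bar R :=
  match k with
  | 0 => g
  | k'.+1 => fun x => (\int[@lebesgue_measure R]_(t in [set: R])
                        iter_int k' g (fun j => if j == k' then t else x j))%E
  end.

Definition vec_of (n : nat) (x : nat -> R) : 'cV[R]_n := \col_(i < n) x i.

Definition volume (n : nat) (S : set 'cV[R]_n) : \bar R :=
  iter_int n (fun x => (if `[< S (vec_of n x) >] then 1 else 0)%:E) (fun _ => 0).

End Defs.

(* Main.v *)
Require Import Defs.
From HB Require Import structures.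
From mathcomp Require Import all_boot all_order all_algebra.
From mathcomp Require Import finmap.
From mathcomp Require Import all_classical all_reals all_analysis.
From mathcomp Require Import measurable_realfun polyrcf.
From mathcomp Require Import zify ring lra.
Set Implicit Arguments. Unset Strict Implicit. Unset Printing Implicit Defensive.
Import Order.TTheory GRing.Theory Num.Theory.
Local Open Scope classical_set_scope.
Local Open Scope ring_scope.

(** Polynomiality.  Summing a polynomial over [L <= t <= U] gives [G U - G (L - 1)]
with [G] a polynomial antidifference.  If a variable occurs in a totally unimodular
system only with coefficients 0, 1, -1, then its bounds are integral affine forms in
the remaining variables and in the dilation factor [k].  Splitting according to which
upper bound is the least (resp. which lower bound is the greatest) replaces the
system by one of its pivots, which is again totally unimodular.  Eliminating all the
variables in this way leaves finitely many polynomials in [k], each multiplied by the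
indicator of conditions [0 <= a * k + c], which are eventually constant.  The
variables are bounded linearly in [k] by Farkas' lemma.

Leading coefficient.  The volume is the iterated integral of an indicator function;
comparing the indicator at [x] with the one at [floor (k x)] gives
[N (b k - C) <= V k^n <= N (b k + C)] for a constant [C].  Translating by an integral
point of a deep dilate gives [N (b k + C) <= N (b (k + j) - C)] for some fixed [j], so
[N (b k + c)] lies between [V (k - j)^n] and [V (k + j)^n]. *)

(** * Linear bounds on bounded polyhedra *)

(** Chooses the eliminated variable between all its lower and all its upper bounds; either list may
    be empty. *)
Lemma between_seqs (R : realFieldType) (ls us : seq R) :
  (forall l u, l \in ls -> u \in us -> l <= u) ->
  exists t, (forall l, l \in ls -> l <= t) /\ (forall u, u \in us -> t <= u).
Proof.
elim: ls => [|l ls IH] H.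
  elim: us {H} => [|u us [t [_ IH]]]; first by exists 0.
  exists (Num.min t u); split=> // v; rewrite inE ge_min => /predU1P[->|/IH->//].
  by rewrite lexx orbT.
have [|t [tl tu]] := IH; first by move=> l' u' l's; apply: H; rewrite inE l's orbT.
exists (Num.max t l); split=> [v|v vs]; last by rewrite ge_max tu// H// mem_head.
by rewrite inE le_max => /predU1P[->|/tl->//]; rewrite lexx orbT.
Qed.

(* Fourier-Motzkin elimination of the last variable; [Q a b c] stands for any
   property of inequalities stable under nonnegative combinations. *)
Lemma farkas_cone (R : realFieldType) (Q : (nat -> R) -> R -> R -> Prop) :
  (forall s t a b c a' b' c', 0 <= s -> 0 <= t -> Q a b c -> Q a' b' c' ->
     Q (fun j => s * a j + t * a' j) (s * b + t * b') (s * c + t * c')) ->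
  forall (r : nat) (I : finType) (a : I -> nat -> R) (b c : I -> R),
  (forall i, Q (a i) (b i) (c i)) ->
  (forall i j, (r <= j)%N -> a i j = 0) ->
  (exists x : nat -> R, forall i, \sum_(j < r) a i j * x j <= b i) \/
  (exists a' b' c', [/\ Q a' b' c', a' =1 (fun=> 0) & b' < 0]).
Proof.
move=> QC; elim=> [|r IH] I a b c Qabc a0.
  have [/forallP b0|] := boolP [forall i, 0 <= b i].
    by left; exists (fun=> 0) => i; rewrite big_ord0.
  rewrite negb_forall => /existsP[i]; rewrite -ltNge => bi.
  by right; exists (a i), (b i), (c i); split=> // j; rewrite a0.
(* Multipliers for the pair of rows [p]. A first row free of variable [r] is kept as it is; a
   positive and a negative coefficient are weighted so that they cancel; every other pair gives the
   trivial inequality with both multipliers zero. *)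
pose e1 (p : I * I) := if a p.1 r == 0 then 1
  else if (0 < a p.1 r) && (a p.2 r < 0) then - a p.2 r else 0.
pose e2 (p : I * I) := if a p.1 r == 0 then 0
  else if (0 < a p.1 r) && (a p.2 r < 0) then a p.1 r else 0.
have e1_ge0 p : 0 <= e1 p.
  rewrite /e1; case: ifP => // _; case: ifP => // /andP[_]; lra.
have e2_ge0 p : 0 <= e2 p.
  rewrite /e2; case: ifP => // _; case: ifP => // /andP[+ _]; lra.
have [||[x xP]|] := IH (I * I)%type
   (fun p j => e1 p * a p.1 j + e2 p * a p.2 j)
   (fun p => e1 p * b p.1 + e2 p * b p.2)
   (fun p => e1 p * c p.1 + e2 p * c p.2).
- by move=> p; apply: QC.
- move=> p j; rewrite leq_eqVlt => /orP[/eqP<-|rj]; last by rewrite !a0// !mulr0 addr0.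
  rewrite /e1 /e2; case: eqP => [->|_]; first by rewrite mulr0 mul0r addr0.
  by case: ifP => _; rewrite ?mul0r ?addr0// mulNr mulrC addNr.
- left; pose S i := \sum_(j < r) a i j * x j.
  have SP p : e1 p * S p.1 + e2 p * S p.2 <= e1 p * b p.1 + e2 p * b p.2.
    apply: le_trans (xP p); rewrite !mulr_sumr -big_split /=.
    by rewrite le_eqVlt; apply/orP; left; apply/eqP/eq_bigr => j _; rewrite mulrDl !mulrA.
  pose bd i := (b i - S i) / a i r.
  (* Rows with a negative coefficient at [r] give lower bounds for the new variable, those with a
     positive one give upper bounds. *)
  have [|t [tl tu]] := @between_seqs R [seq bd i | i <- enum I & a i r < 0]
                                       [seq bd i | i <- enum I & 0 < a i r].
    move=> l u /mapP[i' + ->] /mapP[i + ->]; rewrite !mem_filter => /andP[ai' _] /andP[ai _].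
    have := SP (i, i'); rewrite /e1 /e2 /= (gt_eqF ai) ai ai' /= /bd => h.
    rewrite ler_pdivlMr// mulrAC ler_ndivrMr//; lra.
  exists (fun j => if j == r then t else x j) => i.
  rewrite big_ord_recr /= eqxx.
  rewrite (eq_bigr (fun j : 'I_r => a i j * x j)) -/(S i); last first.
    by move=> j _; rewrite (ltn_eqF (ltn_ord j)).
  case: (ltgtP (a i r) 0) => air.
  + have /tl : bd i \in [seq bd i | i <- enum I & a i r < 0].
      by apply: map_f; rewrite mem_filter air mem_enum.
    by rewrite /bd ler_ndivrMr//; lra.
  + have /tu : bd i \in [seq bd i | i <- enum I & 0 < a i r].
      by apply: map_f; rewrite mem_filter air mem_enum.
    by rewrite /bd ler_pdivlMr//; lra.
  (* A row free of [r] is recovered from its pair with itself, whose multipliers are 1 and 0. *)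
  + have := SP (i, i); rewrite /e1 /e2 /= air eqxx; lra.
- by right.
Qed.

(* Farkas for the infeasible system [A x <= b], [x >= 0], [x j >= M0 + 1]: in
   [Q], the multiplier [w] of the last inequality is kept apart. *)
Lemma dilation_bound (R : realFieldType) (m n : nat) (A : 'M[R]_(m, n))
    (b c : 'cV[R]_m) (M0 : R) (j : 'I_n) :
  (forall x : 'cV[R]_n, (forall i, (A *m x) i 0 <= b i 0) -> (forall i, 0 <= x i 0) ->
     x j 0 <= M0) ->
  exists M M' K : R, forall (k : R) (x : 'cV[R]_n), K <= k ->
    (forall i, (A *m x) i 0 <= k * b i 0 + c i 0) -> (forall i, 0 <= x i 0) ->
    x j 0 <= M * k + M'.
Proof.
move=> bnd.
pose Pk (k : R) (x : 'cV[R]_n) :=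
  (forall i, (A *m x) i 0 <= k * b i 0 + c i 0) /\ (forall i, 0 <= x i 0).
pose Q (a : nat -> R) (be ga : R) := exists2 w, 0 <= w & forall k x, 0 <= k -> Pk k x ->
  \sum_(l < n) a l * x l 0 + w * x j 0 <= (be + w * (M0 + 1)) * k + ga.
have QC s t a be ga a' be' ga' : 0 <= s -> 0 <= t -> Q a be ga -> Q a' be' ga' ->
     Q (fun l => s * a l + t * a' l) (s * be + t * be') (s * ga + t * ga').
  move=> s0 t0 [w w0 H] [w' w'0 H']; exists (s * w + t * w'); first by rewrite addr_ge0// mulr_ge0.
  move=> k x k0 xP; have := ler_wpM2l s0 (H k x k0 xP); have := ler_wpM2l t0 (H' k x k0 xP).
  have -> : \sum_(l < n) (s * a l + t * a' l) * x l 0 =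
      s * (\sum_(l < n) a l * x l 0) + t * (\sum_(l < n) a' l * x l 0).
    by rewrite !mulr_sumr -big_split; apply: eq_bigr => l _; rewrite mulrDl !mulrA.
  lra.
pose dl (l : 'I_n) (i : nat) : R := - (i == l)%:R.
have dlE l (x : 'I_n -> R) : \sum_(i < n) dl l i * x i = - x l.
  rewrite (bigD1 l)//= /dl eqxx mulN1r big1 ?addr0// => i il.
  by have /negbTE -> : (i != l :> nat); rewrite ?oppr0 ?mul0r.
(* Three kinds of rows: the system itself, the sign conditions, and [x j >= M0 + 1]. The last is not
   valid on the polyhedron, but it satisfies [Q] with [w = 1], where both sides cancel. *)
pose a (i : 'I_m + 'I_n + unit) : nat -> R := match i with
  | inl (inl i) => fun l => if insub l is Some l' then A i l' else 0
  | inl (inr l) => dl l | inr _ => dl j end.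
pose be (i : 'I_m + 'I_n + unit) : R := match i with
  | inl (inl i) => b i 0 | inl (inr l) => 0 | inr _ => - (M0 + 1) end.
pose ga (i : 'I_m + 'I_n + unit) : R := if i is inl (inl i) then c i 0 else 0.
have aE i (x : 'I_n -> R) : \sum_(l < n) a (inl (inl i)) l * x l = \sum_(l < n) A i l * x l.
  by apply: eq_bigr => l _; rewrite /a /= insubT//= => lP; congr (A _ _ * _); exact: val_inj.
have [||[x xP]|[a' [be' [ga' [[w w0 wP] a'0 be'0]]]]] := farkas_cone QC (r := n) (a := a) (b := be) (c := ga).
- move=> [[i|l]|[]].
  + exists 0 => // k x k0 [xA _]; rewrite aE mul0r addr0 mul0r addr0 /be /ga mulrC.
    by have := xA i; rewrite mxE.
  + exists 0 => // k x k0 [_ xl]; rewrite [a _]/= [be _]/= [ga _]/= dlE.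
    by have := xl l; lra.
  + exists 1 => // k x k0 _; rewrite [a _]/= [be _]/= [ga _]/= dlE; lra.
- move=> [[i|l]|[]] l' nl /=.
  + by rewrite insubF// ltnNge nl.
  + by rewrite /dl gtn_eqF ?oppr0// (leq_trans _ nl).
  + by rewrite /dl gtn_eqF ?oppr0// (leq_trans _ nl).
- have : (\col_l x l) j 0 <= M0.
    apply: bnd => [i|l].
      rewrite mxE; have := xP (inl (inl i)).
      rewrite (aE i (fun l => x l)) /be => h; apply: le_trans h.
      by rewrite le_eqVlt; apply/orP; left; apply/eqP/eq_bigr => l _; rewrite mxE.
    have := xP (inl (inr l)); rewrite [a _]/= [be _]/= (dlE l (fun l => x l)) mxE; lra.
  have := xP (inr tt); rewrite [a _]/= [be _]/= (dlE j (fun l => x l)) mxE; lra.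
- have wP' k x : 0 <= k -> Pk k x -> w * x j 0 <= (be' + w * (M0 + 1)) * k + ga'.
    move=> k0 /(wP k x k0); rewrite big1 ?add0r// => l _; by rewrite a'0 mul0r.
  (* If [w = 0], the certificate reads [0 <= be' * k + ga'] with [be' < 0], so the dilate is empty
     for large [k] and any bound will do. If [w > 0], dividing by [w] gives the linear bound. *)
  have [w_eq0|w_neq0] := eqVneq w 0.
    exists 0, 0, (`|ga'| / - be' + 1) => k x kK xA x0; exfalso.
    have be'0' : 0 < - be' by rewrite oppr_gt0.
    have g0 : 0 <= `|ga'| / - be' by rewrite divr_ge0// ltW.
    have k0 : 0 <= k by apply: le_trans kK; lra.
    have := wP' k x k0 (conj xA x0); rewrite w_eq0 !mul0r addr0.
    have : `|ga'| / - be' < k by lra.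
    rewrite ltr_pdivrMr//; have := ler_norm ga'; lra.
  have wgt0 : 0 < w by rewrite lt_def w_neq0.
  exists ((be' + w * (M0 + 1)) / w), (ga' / w), 0 => k x k0 xA x0.
  have := wP' k x k0 (conj xA x0).
  by rewrite mulrC -ler_pdivlMr// mulrDl mulrAC.
Qed.

(** * Affine forms *)

Definition upd (T : Type) (x : nat -> T) (v : nat) (t : T) : nat -> T :=
  fun j => if j == v then t else x j.

(* The constant term is stored in slot [N]. *)
Definition aff (N : nat) (a x : nat -> int) : int :=
  \sum_(j < N) a j * x j + a N.

Lemma aff_upd N a x v t : (v < N)%N ->
  aff N a (upd x v t) = aff N a x + a v * (t - x v).
Proof.
move=> vN; rewrite /aff (bigD1 (Ordinal vN)) //= [in RHS](bigD1 (Ordinal vN)) //=.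
rewrite /upd eqxx.
rewrite (eq_bigr (fun j : 'I_N => a j * x j)); first by ring.
by move=> j jv; rewrite ifN.
Qed.

Lemma affD N a b x : aff N (fun j => a j + b j) x = aff N a x + aff N b x.
Proof.
rewrite /aff addrACA -big_split /=; congr (_ + _).
by apply: eq_bigr => j _; rewrite mulrDl.
Qed.

Lemma affZ N c a x : aff N (fun j => c * a j) x = c * aff N a x.
Proof.
rewrite /aff mulrDr mulr_sumr; congr (_ + _).
by apply: eq_bigr => j _; rewrite mulrA.
Qed.

Lemma eq_aff N a b x : a =1 b -> aff N a x = aff N b x.
Proof.
by move=> ab; rewrite /aff ab; congr (_ + _); apply: eq_bigr => j _; rewrite ab.
Qed.

Definition coordf (v : nat) : nat -> int := fun j => (j == v)%:R.

Lemma aff_coordf N v x : (v < N)%N -> aff N (coordf v) x = x v.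
Proof.
move=> vN; rewrite /aff /coordf (gtn_eqF vN) addr0 (bigD1 (Ordinal vN)) //= eqxx mul1r.
rewrite big1 ?addr0// => j jv.
by have /negbTE -> : (j != v :> nat); rewrite ?mul0r.
Qed.

Lemma aff_cst N c x : aff N (fun j => if j == N then c else 0) x = c.
Proof.
rewrite /aff eqxx big1 ?add0r// => j _.
by rewrite (ltn_eqF (ltn_ord j)) mul0r.
Qed.

(** * Polynomial functions *)

(** Polynomial functions of total degree at most [d], generated by products with affine forms rather
    than by monomials: substituting an affine form for a variable then follows by induction, with no
    expansion. *)
Inductive polyfun (R : numFieldType) (N : nat) : nat -> ((nat -> int) -> R) -> Prop :=
| polyfun_const d c : polyfun N d (fun=> c)
| polyfun_mul d a F : polyfun N d F -> polyfun N d.+1 (fun x => (aff N a x)%:~R * F x)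
| polyfun_add d F G : polyfun N d F -> polyfun N d G -> polyfun N d (fun x => F x + G x)
| polyfun_ext d F G : polyfun N d F -> F =1 G -> polyfun N d G.

Lemma polyfun_leq (R : numFieldType) N d e (F : (nat -> int) -> R) :
  (d <= e)%N -> polyfun N d F -> polyfun N e F.
Proof.
move=> de H; elim: H e de => {d F}.
- by move=> d c e _; exact: polyfun_const.
- by move=> d a F _ IH [|e] // de; apply: polyfun_mul; apply: IH.
- by move=> d F G _ IHF _ IHG e de; apply: polyfun_add; [exact: IHF|exact: IHG].
- by move=> d F G _ IHF FG e de; apply: polyfun_ext FG; exact: IHF.
Qed.

Lemma polyfun_scale (R : numFieldType) N d c (F : (nat -> int) -> R) :
  polyfun N d F -> polyfun N d (fun x => c * F x).
Proof.
elim=> {d F}.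
- by move=> d c'; exact: polyfun_const.
- by move=> d a F _ IH; apply: (polyfun_ext (polyfun_mul a IH)) => x; rewrite mulrCA.
- by move=> d F G _ IHF _ IHG; apply: (polyfun_ext (polyfun_add IHF IHG)) => x; rewrite mulrDr.
- by move=> d F G _ IHF FG; apply: (polyfun_ext IHF) => x; rewrite FG.
Qed.

Lemma polyfun_subst (R : numFieldType) N v a d (F : (nat -> int) -> R) : (v < N)%N ->
  polyfun N d F -> polyfun N d (fun x => F (upd x v (aff N a x))).
Proof.
move=> vN; elim=> {d F}.
- by move=> d c; exact: polyfun_const.
- move=> d b F _ IH.
  apply: (polyfun_ext (polyfun_mul (fun j => b j + b v * (a j + (-1) * coordf v j)) IH)) => x.
  by rewrite aff_upd// affD affZ affD affZ aff_coordf// mulN1r.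
- by move=> d F G _ IHF _ IHG; exact: polyfun_add.
- by move=> d F G _ IHF FG; apply: (polyfun_ext IHF) => x; rewrite FG.
Qed.

(** The rising factorial, basis for discrete integration: its backward difference obeys the power
    rule [rising_diff]. *)
Definition rising (t : int) (i : nat) : int := \prod_(j < i) (t + j%:Z).

Lemma risingS t i : rising t i.+1 = (t + i%:Z) * rising t i.
Proof. by rewrite /rising big_ord_recr /= mulrC. Qed.

Lemma rising_diff t i :
  rising t i.+1 - rising (t - 1) i.+1 = i.+1%:Z * rising t i.
Proof.
have e : rising (t - 1) i.+1 = (t - 1) * rising t i.
  rewrite /rising big_ord_recl /= addr0; congr (_ * _).
  by apply: eq_bigr => j _; rewrite /bump /= add1n intS; ring.
by rewrite e risingS intS; ring.
Qed.

Lemma polyfun_rising (R : numFieldType) N v i d (F : (nat -> int) -> R) : (v < N)%N ->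
  polyfun N d F -> polyfun N (i + d) (fun x => (rising (x v) i)%:~R * F x).
Proof.
move=> vN HF; elim: i => [|i IH].
  by apply: (polyfun_ext HF) => x; rewrite /rising big_ord0 mul1r.
apply: (polyfun_ext (polyfun_mul (fun j => coordf v j + (if j == N then i%:Z else 0)) IH)) => x.
by rewrite affD aff_coordf// aff_cst risingS intrM mulrA.
Qed.

(* With the factor [rising (x v) i] the induction closes up: a factor [x v] only
   shifts [i]. *)
Lemma polyfun_antidiff_rising (R : numFieldType) N v d (F : (nat -> int) -> R) : (v < N)%N ->
  polyfun N d F -> forall i, exists2 H : (nat -> int) -> R, polyfun N (i + d).+1 H &
    forall x t, H (upd x v t) - H (upd x v (t - 1)) =
                (rising t i)%:~R * F (upd x v t).
Proof.
move=> vN; elim=> {d F}.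
- move=> d c i.
  exists (fun x => (rising (x v) i.+1)%:~R * (i.+1%:R^-1 * c)).
    by rewrite -addSn; apply: polyfun_rising => //; exact: polyfun_const.
  move=> x t; rewrite /upd eqxx -mulrBl -intrB rising_diff intrM -pmulrn.
  have i0 : i.+1%:R != 0 :> R by rewrite pnatr_eq0.
  by rewrite [i.+1%:R * _]mulrC -mulrA mulVKf.
- move=> d a F _ IH i; have [H0 PH0 H0E] := IH i; have [H1 PH1 H1E] := IH i.+1.
  (* The affine factor is [a v * x v] plus a form free of [x v], which passes through the difference
     unchanged. Since [t * rising t i = rising t i.+1 - i * rising t i], the first part is handled
     by the antidifferences [H1] and [H0] for [i.+1] and [i]. *)
  pose al : R := (a v)%:~R.
  exists (fun x => (al * H1 x + (- (i%:R * al)) * H0 x) +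
     (aff N (fun j => a j + (- a v) * coordf v j) x)%:~R * H0 x).
    apply: polyfun_add; last by rewrite addnS; apply: polyfun_mul.
    apply: polyfun_add; first by rewrite addnS -addSn; apply: polyfun_scale.
    by apply: polyfun_scale; apply: polyfun_leq PH0; rewrite addnS.
  move=> x t.
  have uE s : upd x v s v = s by rewrite /upd eqxx.
  rewrite !(affD, affZ) !aff_coordf// !aff_upd// !uE.
  set h1 := H1 (upd x v t); set h1' := H1 (upd x v (t - 1)).
  set h0 := H0 (upd x v t); set h0' := H0 (upd x v (t - 1)).
  have e1 : h1 = h1' + (rising t i.+1)%:~R * F (upd x v t) by rewrite -H1E addrC subrK.
  have e0 : h0 = h0' + (rising t i)%:~R * F (upd x v t) by rewrite -H0E addrC subrK.
  rewrite e1 e0 risingS !(intrD, intrM, intrB, intrN, mulrNz) /al pmulrn; ring.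
- move=> d F G _ IHF _ IHG i; have [H0 PH0 H0E] := IHF i; have [H1 PH1 H1E] := IHG i.
  exists (fun x => H0 x + H1 x); first exact: polyfun_add.
  by move=> x t; rewrite mulrDr -H0E -H1E; ring.
- move=> d F G _ IHF FG i; have [H0 PH0 H0E] := IHF i.
  by exists H0 => // x t; rewrite H0E FG.
Qed.

Lemma polyfun_antidiff (R : numFieldType) N v d (F : (nat -> int) -> R) : (v < N)%N ->
  polyfun N d F -> exists2 H : (nat -> int) -> R, polyfun N d.+1 H &
    forall x t, H (upd x v t) - H (upd x v (t - 1)) = F (upd x v t).
Proof.
move=> vN /(polyfun_antidiff_rising vN)/(_ 0%N)[H PH HE]; exists H => // x t.
by rewrite HE /rising big_ord0 mul1r.
Qed.

Lemma polyfun_poly (R : numFieldType) N v d (F : (nat -> int) -> R) x : (v < N)%N ->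
  polyfun N d F -> exists2 p : {poly R}, (size p <= d.+1)%N &
    forall k, F (upd x v k) = p.[k%:~R].
Proof.
move=> vN; elim=> {d F}.
- move=> d c; exists c%:P; last by move=> k; rewrite hornerC.
  by rewrite (leq_trans (size_polyC_leq1 _)).
- move=> d a F _ [p sp pE].
  exists (((a v)%:~R *: 'X + (aff N a x - a v * x v)%:~R%:P) * p).
    rewrite (leq_trans (size_polyMleq _ _))//.
    have s2 : (size ((a v)%:~R *: 'X + (aff N a x - a v * x v)%:~R%:P : {poly R})%R <= 2)%N.
      rewrite (leq_trans (size_polyD _ _))// geq_max (leq_trans (size_scale_leq _ _)) ?size_polyX//=.
      by rewrite (leq_trans (size_polyC_leq1 _)).
    by rewrite -ltnS; move: s2 sp; case: (size _); case: (size p); lia.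
  move=> k; rewrite hornerM -pE !hornerE aff_upd//; congr (_ * _).
  by rewrite -intrM -intrD; congr (_%:~R); ring.
- move=> d F G _ [p sp pE] _ [q sq qE]; exists (p + q).
    by rewrite (leq_trans (size_polyD _ _))// geq_max sp.
  by move=> k; rewrite pE qE hornerD.
- move=> d F G _ [p sp pE] FG; exists p => // k.
  by rewrite -FG.
Qed.

(** * Pivoting in totally unimodular systems *)

Definition sign01 (d : int) := d = 0 \/ d = 1 \/ d = -1.

(** Only the columns in [s], those of the variables still to be summed, are constrained; the slots
    of the dilation factor and of the constant term may hold arbitrary integers. *)
Definition TU_on (I : Type) (s : seq nat) (D : I -> nat -> int) :=
  forall (k : nat) (f : 'I_k -> I) (g : 'I_k -> nat),
    injective f -> injective g -> (forall i, g i \in s) ->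
    sign01 (\det (\matrix_(i, j) D (f i) (g j))).

Lemma TU_on_entry (I : Type) s (D : I -> nat -> int) i v :
  TU_on s D -> v \in s -> sign01 (D i v).
Proof.
move=> TUD vs.
have := TUD 1%N (fun=> i) (fun=> v).
rewrite det_mx11 mxE; apply => //.
- by move=> a b _; rewrite (ord1 a) (ord1 b).
- by move=> a b _; rewrite (ord1 a) (ord1 b).
Qed.

(* Row [i] reads [x v = w i] when tight; substituting this value in row [i']
   compares the two bounds on [x v].  The correction in the constant slot [N]
   makes the comparison of bounds of the same kind strict when [i' < i]. *)
Definition pivot (N m : nat) (D : 'I_m -> nat -> int) (i : 'I_m) (v : nat)
    (i' : 'I_m) (j : nat) : int :=
  D i' j - D i v * D i' v * D i j -
  ((D i' v == D i v) && (i' < i)%N && (j == N))%:R.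

(** If row [i] is selected, the minor vanishes, because the pivot clears that row on [s]. Otherwise
    the minor is a Schur complement: up to the sign [D i v] it equals the minor of [D] bordered by
    row [i] and column [v]. *)
Lemma TU_pivot N m s (D : 'I_m -> nat -> int) i v :
  v \notin s -> N \notin s -> D i v * D i v = 1 ->
  TU_on (v :: s) D -> TU_on s (pivot N D i v).
Proof.
move=> vs Ns s1 TUD k f g fI gI gs.
have pE a b : pivot N D i v a (g b) = D a (g b) - D i v * D a v * D i (g b).
  rewrite /pivot; have /negbTE -> : g b != N by apply: contraNneq Ns => <-.
  by rewrite andbF subr0.
case: (pickP (fun a => f a == i)) => [a /eqP fa|nf].
  left; rewrite (expand_det_row _ a) big1// => b _.
  by rewrite mxE pE fa s1 mul1r subrr mul0r.
pose f' (a : 'I_(1 + k)) := match fintype.split a with inl _ => i | inr b => f b end.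
pose g' (a : 'I_(1 + k)) := match fintype.split a with inl _ => v | inr b => g b end.
have f'I : injective f'.
  move=> a b; rewrite /f' -[a]splitK -[b]splitK !unsplitK.
  case: (fintype.split a) => a'; case: (fintype.split b) => b' /=.
  - by rewrite (ord1 a') (ord1 b').
  - by move=> /esym/eqP; rewrite nf.
  - by move=> /eqP; rewrite nf.
  - by move=> /fI ->.
have g'I : injective g'.
  move=> a b; rewrite /g' -[a]splitK -[b]splitK !unsplitK.
  case: (fintype.split a) => a'; case: (fintype.split b) => b' /=.
  - by rewrite (ord1 a') (ord1 b').
  - by move=> e; move: (gs b'); rewrite -e (negbTE vs).
  - by move=> e; move: (gs a'); rewrite e (negbTE vs).
  - by move=> /gI ->.
have g's a : g' a \in v :: s.
  by rewrite /g'; case: (fintype.split a) => b; rewrite inE ?eqxx// gs orbT.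
have := TUD _ f' g' f'I g'I g's.
pose U : 'M[int]_(1, k) := \row_b D i (g b).
pose W : 'M[int]_(k, 1) := \col_a D (f a) v.
pose B : 'M[int]_(k, k) := \matrix_(a, b) D (f a) (g b).
have -> : \matrix_(a, b) D (f' a) (g' b) = block_mx (D i v)%:M U W B.
  apply/matrixP => a b; rewrite mxE /f' /g' -[a in RHS]splitK -[b in RHS]splitK.
  case: (fintype.split a) => a'; case: (fintype.split b) => b' /=.
  - by rewrite block_mxEul mxE (ord1 a') (ord1 b') eqxx.
  - by rewrite block_mxEur mxE.
  - by rewrite block_mxEdl mxE.
  - by rewrite block_mxEdr mxE.
have e : block_mx 1%:M 0 (- D i v *: W) 1%:M *m block_mx (D i v)%:M U W B =
    block_mx (D i v)%:M U 0 (\matrix_(a, b) pivot N D i v (f a) (g b)).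
  rewrite mulmx_block !mul1mx !mul0mx !addr0; congr block_mx.
    by rewrite mul_mx_scalar scalerA mulrN s1 scaleN1r addNr.
  apply/matrixP => a b; rewrite !mxE big_ord1 !mxE pE; ring.
have /(congr1 determinant) := e.
rewrite det_mulmx det_lblock det_ublock !det1 !mul1r det_scalar1 => ->.
have [->|->] : D i v = 1 \/ D i v = -1.
- by have [e0|] := TU_on_entry i TUD (mem_head v s); [rewrite e0 in s1|].
- by rewrite mul1r.
- by rewrite mulN1r; move: (\det _) => d; rewrite /sign01; lia.
Qed.

Lemma aff_pivot N m (D : 'I_m -> nat -> int) i v i' x :
  aff N (pivot N D i v i') x =
  aff N (D i') x - D i v * D i' v * aff N (D i) x -
  ((D i' v == D i v) && (i' < i)%N)%:R.
Proof.
rewrite (@eq_aff _ _ (fun j => (D i' j + (- (D i v * D i' v)) * D i j) +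
   (if j == N then - ((D i' v == D i v) && (i' < i)%N)%:R else 0))).
  by rewrite !(affD, affZ) aff_cst mulNr.
move=> j; rewrite /pivot mulNr; congr (_ + _).
by case: (j == N); rewrite ?andbT// andbF oppr0.
Qed.

(** * Summation of one variable *)

(* Ties are broken by the index, so exactly one term survives. *)
Lemma sum_first_argmin (V : nmodType) m (P : pred 'I_m) (w : 'I_m -> int) i0 : P i0 ->
  exists i1, [/\ P i1, (forall i, P i -> w i1 <= w i) &
    forall (Q : pred 'I_m) (g : 'I_m -> V),
    \sum_(i | P i && [forall (i' | P i'), w i + (i' < i)%N%:R <= w i'] && Q i) g i =
    if Q i1 then g i1 else 0].
Proof.
move=> Pi0.
(* As [i < m], minimizing [w i * m + i] is lexicographic minimization of the pair [(w i, i)]. *)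
case: (@Order.TotalTheory.arg_minP _ _ _ i0 P (fun i => w i * m%:Z + i%:Z) Pi0) => i1 Pi1 mi1.
exists i1; split => //.
  move=> i Pi; have := mi1 _ Pi; have := ltn_ord i; have := ltn_ord i1; nia.
have H i : P i && [forall (i' | P i'), w i + (i' < i)%N%:R <= w i'] = (i == i1).
  apply/andP/eqP => [[Pi /forallP min]|->].
    have /implyP/(_ Pi1) := min i1; have := mi1 _ Pi.
    have := ltn_ord i; have := ltn_ord i1 => l1 l h1 h2.
    apply/val_inj => /=; case: ltnP h2 => h3 /= h2; nia.
  split=> //; apply/forallP => i'; apply/implyP => Pi'.
  have := mi1 _ Pi'; have := ltn_ord i'; have := ltn_ord i1.
  by case: ltnP => h3 /= h1 h2; nia.
move=> Q g; rewrite (eq_bigl (fun i => (i == i1) && Q i)); last by move=> i; rewrite H.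
case: ifP => [Q1|Q1].
  by rewrite (bigD1 i1) ?eqxx//= big1 ?addr0// => i /andP[/andP[/eqP-> _]]; rewrite eqxx.
by rewrite big1// => i /andP[/eqP->]; rewrite Q1.
Qed.

Lemma telescope_int (V : zmodType) (g G : int -> V) (B : nat) (lo hi : int) :
  (forall t, G t - G (t - 1) = g t) -> 0 <= lo -> hi < B%:Z ->
  \sum_(t < B | (lo <= t%:Z <= hi)%R) g t%:Z =
  if lo <= hi then G hi - G (lo - 1) else 0.
Proof.
move=> GE lo0; case: lo lo0 => // lo _; case: (leP (Posz lo) hi) => [|lh]; last first.
  by move=> _; rewrite big1// => t; lia.
case: hi => // hi lh hB.
have -> : \sum_(t < B | (Posz lo <= t%:Z <= Posz hi)%R) g t%:Z =
          \sum_(lo <= t < hi.+1) g t%:Z.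
  rewrite (big_nat_widen lo hi.+1 B); last by lia.
  rewrite [RHS](big_nat_widenl _ 0%N)// big_mkord.
  apply: eq_bigl => t; lia.
(* Evaluating [G] at [s - 1] lets the telescoping over naturals end at [G (-1)] when [lo] is 0. *)
rewrite (eq_bigr (fun t => (fun s : nat => G (s%:Z - 1)) t.+1 - (fun s : nat => G (s%:Z - 1)) t)).
  rewrite telescope_sumr /=; last by lia.
  by congr (G _ - G _); lia.
by move=> t _; rewrite -GE; congr (G _ - G _); lia.
Qed.

(* [sg i] is the sign of the summation variable in row [i]: an upper bound
   [w i] (sign -1), a lower bound [w i] (sign 1), or a condition [0 <= w i]. *)
Lemma sum_between_bounds (V : zmodType) m (sg w : 'I_m -> int) (B : nat)
    (g G : int -> V) (il iu : 'I_m) :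
  (forall i, sign01 (sg i)) -> (forall t, G t - G (t - 1) = g t) ->
  sg il = 1 -> w il = 0 -> sg iu = -1 -> w iu < B%:Z ->
  let row (t : int) i := if sg i == 0 then 0 <= w i else 0 <= sg i * (t - w i) in
  let prow i i' := if sg i' == 0 then 0 <= w i'
     else 0 <= sg i' * (w i - w i') - ((sg i' == sg i) && (i' < i)%N)%:R in
  \sum_(t < B | [forall i, row t%:Z i]) g t%:Z =
  \sum_(i | (sg i == -1) && [forall i', prow i i']) G (w i) -
  \sum_(i | (sg i == 1) && [forall i', prow i i']) G (w i - 1).
Proof.
move=> sg01 GE sl wl su wu row prow.
have su' : sg iu == -1 by rewrite su.
have sl' : sg il == 1 by rewrite sl.
have [iU [Uu minU sumU]] := @sum_first_argmin V m (fun i => sg i == -1) w iu su'.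
have [iL [Ll maxL sumL]] := @sum_first_argmin V m (fun i => sg i == 1) (fun i => - w i) il sl'.
pose Z := [forall i, (sg i == 0) ==> (0 <= w i)].
have rowE t : [forall i, row t i] = Z && (w iL <= t <= w iU).
  apply/forallP/and3P => [H|[/forallP HZ HL HU] i].
    split.
    - apply/forallP => i; apply/implyP => s0; have := H i; by rewrite /row s0.
    - by have := H iL; rewrite /row (eqP Ll) /=; lia.
    - by have := H iU; rewrite /row (eqP Uu) /=; lia.
  rewrite /row; case: ifP => s0; first exact: implyP (HZ i) s0.
  have [s|[s|s]] := sg01 i; rewrite s.
  - by rewrite s in s0.
  - by have := maxL i; rewrite s => /(_ isT); lia.
  - by have := minU i; rewrite s => /(_ isT); lia.
(* The conditions [prow i] single out the first least upper bound, and they also contain [Z] and the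
   nonemptiness of the interval. The two selected terms therefore vanish together exactly when no
   [t] is feasible. *)
have prowU i : sg i == -1 -> [forall i', prow i i'] =
    [forall (i' | sg i' == -1), w i + (i' < i)%N%:R <= w i'] && (Z && (w iL <= w i)).
  move=> /eqP si; apply/forallP/and3P => [H|[/forallP HU /forallP HZ HL] i'].
    split.
    - apply/forallP => i'; apply/implyP => /eqP s; have := H i'; rewrite /prow s si /=.
      by case: ltnP => _ /=; lia.
    - apply/forallP => i'; apply/implyP => s; have := H i'; by rewrite /prow s.
    - by have := H iL; rewrite /prow (eqP Ll) si /=; lia.
  rewrite /prow; case: ifP => s0; first exact: implyP (HZ i') s0.
  have [s|[s|s]] := sg01 i'; rewrite s si.
  - by rewrite s in s0.
  - by have := maxL i'; rewrite s => /(_ isT) /=; lia.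
  - by have := HU i'; rewrite s /=; case: ltnP => _ /=; lia.
have prowL i : sg i == 1 -> [forall i', prow i i'] =
    [forall (i' | sg i' == 1), - w i + (i' < i)%N%:R <= - w i'] && (Z && (w i <= w iU)).
  move=> /eqP si; apply/forallP/and3P => [H|[/forallP HU /forallP HZ HL] i'].
    split.
    - apply/forallP => i'; apply/implyP => /eqP s; have := H i'; rewrite /prow s si /=.
      by case: ltnP => _ /=; lia.
    - apply/forallP => i'; apply/implyP => s; have := H i'; by rewrite /prow s.
    - by have := H iU; rewrite /prow (eqP Uu) si /=; lia.
  rewrite /prow; case: ifP => s0; first exact: implyP (HZ i') s0.
  have [s|[s|s]] := sg01 i'; rewrite s si.
  - by rewrite s in s0.
  - by have := HU i'; rewrite s /=; case: ltnP => _ /=; lia.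
  - by have := minU i'; rewrite s => /(_ isT) /=; lia.
rewrite (eq_bigl (fun t : 'I_B => Z && (w iL <= t%:Z <= w iU))); last by move=> t; rewrite rowE.
rewrite [X in _ = X - _](eq_bigl (fun i => (sg i == -1) &&
   [forall (i' | sg i' == -1), w i + (i' < i)%N%:R <= w i'] && (Z && (w iL <= w i)))); last first.
  by move=> i; case: eqP => // /eqP s; rewrite prowU.
rewrite [X in _ = _ - X](eq_bigl (fun i => (sg i == 1) &&
   [forall (i' | sg i' == 1), - w i + (i' < i)%N%:R <= - w i'] && (Z && (w i <= w iU)))); last first.
  by move=> i; case: eqP => // /eqP s; rewrite prowL.
rewrite (sumU (fun i => Z && (w iL <= w i))) (sumL (fun i => Z && (w i <= w iU))).
case: Z {rowE prowU prowL} => /=; last by rewrite big_pred0// subr0.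
rewrite (telescope_int GE); first by case: ifP; rewrite ?subr0.
- by have := maxL il; rewrite sl wl => /(_ isT); lia.
- by have := minU iu; rewrite su => /(_ isT); lia.
Qed.

(** * Sums of polynomial functions over lattice points *)

Definition holds (N m : nat) (D : 'I_m -> nat -> int) (x : nat -> int) : bool :=
  [forall i, 0 <= aff N (D i) x].

(** Keeps an explicit lower bound 0 and upper bound [up] for each variable still to be summed. As
    these rows have coefficient 0 at the summed variable, pivoting leaves them intact. *)
Definition boxed (m : nat) (up : nat -> int) (s : seq nat) (D : 'I_m -> nat -> int) :=
  forall v, v \in s -> (exists i, D i =1 coordf v) /\
    (exists i, D i =1 fun j => up j - coordf v j).

(** Finite sums of polynomials cut off by totally unimodular systems. All systems can have the same
    number [m] of rows, since a pivot row is not removed but becomes the trivial condition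
    [0 <= 0]. *)
Inductive pwpoly (R : numFieldType) (N m : nat) (up : nat -> int) (s : seq nat) (d : nat) :
    ((nat -> int) -> R) -> Prop :=
| pwpoly_term (D : 'I_m -> nat -> int) F : TU_on s D -> boxed up s D -> polyfun N d F ->
    pwpoly N m up s d (fun x => if holds N D x then F x else 0)
| pwpoly_zero : pwpoly N m up s d (fun=> 0)
| pwpoly_add F G : pwpoly N m up s d F -> pwpoly N m up s d G -> pwpoly N m up s d (fun x => F x + G x)
| pwpoly_ext F G : pwpoly N m up s d F -> F =1 G -> pwpoly N m up s d G.

Lemma pwpoly_sum (R : numFieldType) N m up s d (I : Type) (r : seq I) (P : pred I)
    (F : I -> (nat -> int) -> R) :
  (forall i, P i -> pwpoly N m up s d (F i)) ->
  pwpoly N m up s d (fun x => \sum_(i <- r | P i) F i x).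
Proof.
move=> HF; elim: r => [|i r IH].
  by apply: pwpoly_ext (pwpoly_zero _ _ _ _ _ _) _ => x; rewrite big_nil.
case Pi: (P i).
  by apply: pwpoly_ext (pwpoly_add (HF i Pi) IH) _ => x; rewrite big_cons Pi.
by apply: pwpoly_ext IH _ => x; rewrite big_cons Pi.
Qed.

Definition sum_var (R : nmodType) (Bd : (nat -> int) -> nat) (v : nat)
    (H : (nat -> int) -> R) (x : nat -> int) : R :=
  \sum_(t < Bd x) H (upd x v t%:Z).

(** The box rows confine a variable to values below this number; when [up] takes a negative value
    there is no feasible one, and the absolute value is harmless. *)
Definition box_bound (N : nat) (up x : nat -> int) : nat := (absz (aff N up x)).+1.

Lemma boxed_pivot N m up v s (D : 'I_m -> nat -> int) i :
  v \notin s -> up v = 0 -> D i v != 0 -> boxed up (v :: s) D ->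
  boxed up s (pivot N D i v).
Proof.
move=> vs up0 Dv bD u us.
have uv : (v == u) = false by apply/eqP => e; rewrite e us in vs.
have pE i' : D i' v = 0 -> pivot N D i v i' =1 D i'.
  move=> e j; rewrite /pivot e mulr0 mul0r subr0.
  by rewrite eq_sym (negbTE Dv) /= subr0.
have [|[il ilE] [iu iuE]] := bD u; first by rewrite inE us orbT.
split; [exists il|exists iu] => j; rewrite pE //.
- by rewrite ilE /coordf uv.
- by rewrite iuE /coordf uv up0 subr0.
Qed.

Lemma tight_row (a e t y : int) : e * e = 1 -> a + e * (t - y) = e * (t - (y - e * a)).
Proof.
move=> e2; apply/eqP; rewrite -subr_eq0 (_ : _ - _ = (1 - e * e) * a); last by ring.
by rewrite e2 subrr mul0r.
Qed.

Lemma pwpoly_sum_var (R : numFieldType) N m up v s d (H : (nat -> int) -> R) :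
  (v < N)%N -> v \notin s -> N \notin s -> up v = 0 ->
  pwpoly N m up (v :: s) d H -> pwpoly N m up s d.+1 (sum_var (box_bound N up) v H).
Proof.
move=> vN vs Ns up0; elim=> {H}.
- move=> D F TUD bD HF; have [H PH HE] := polyfun_antidiff vN HF.
  (* As [D i v] is 1 or -1, [bnd i] is the value of [x v] making row [i] tight; its own coefficient
     at [v] cancels. The form [bnd'] is one less, for the lower end [G (lo - 1)] of the telescoping
     sum. *)
  pose bnd i : nat -> int := fun j => coordf v j + (- D i v) * D i j.
  pose bnd' i : nat -> int := fun j => bnd i j + (if j == N then -1 else 0).
  have bndE i x : aff N (bnd i) x = x v - D i v * aff N (D i) x.
    by rewrite affD affZ aff_coordf// mulNr.
  have bnd'E i x : aff N (bnd' i) x = aff N (bnd i) x - 1.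
    by rewrite /bnd' affD aff_cst.
  have [[il ilE] [iu iuE]] := bD v (mem_head _ _).
  have Dsg i := TU_on_entry i TUD (mem_head v s).
  have D2 i : D i v != 0 -> D i v * D i v = 1.
    by have [->|[->|->]] := Dsg i.
  apply: (@pwpoly_ext _ _ _ _ _ _ (fun x =>
    \sum_(i | D i v == -1)
       (if holds N (pivot N D i v) x then H (upd x v (aff N (bnd i) x)) else 0) +
    \sum_(i | D i v == 1)
       (if holds N (pivot N D i v) x then -1 * H (upd x v (aff N (bnd' i) x)) else 0))).
    have tP i : D i v != 0 -> TU_on s (pivot N D i v) /\ boxed up s (pivot N D i v).
      by move=> Di; split; [apply: TU_pivot (D2 i Di) TUD|exact: boxed_pivot].
    apply: pwpoly_add; apply: pwpoly_sum => i /eqP Di; have [|tu bx] := tP i; rewrite ?Di//.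
    + by apply: pwpoly_term => //; exact: polyfun_subst.
    + by apply: pwpoly_term => //; apply: polyfun_scale; exact: polyfun_subst.
  move=> x; rewrite /sum_var -big_mkcond /=.
  pose w i := if D i v == 0 then aff N (D i) x else aff N (bnd i) x.
  have iu1 : D iu v = -1 by rewrite iuE /coordf eqxx up0.
  have il1 : D il v = 1 by rewrite ilE /coordf eqxx.
  have wl : w il = 0.
    by rewrite /w il1 /= bndE il1 mul1r (eq_aff _ _ ilE) aff_coordf// subrr.
  have wu : w iu < (box_bound N up x)%:Z.
    have e : aff N (D iu) x = aff N up x - x v.
      rewrite (@eq_aff N _ (fun j => up j + (-1) * coordf v j)).
        by rewrite affD affZ aff_coordf// mulN1r.
      by move=> j; rewrite iuE mulN1r.
    by rewrite /w iu1 /= bndE iu1 e /box_bound; lia.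
  have := @sum_between_bounds R m (fun i => D i v) w (box_bound N up x)
    (fun t => F (upd x v t)) (fun t => H (upd x v t)) il iu Dsg (HE x) il1 wl iu1 wu.
  set X := (X in X = _ -> _).
  have -> : X = \sum_(t < box_bound N up x | holds N D (upd x v t%:Z)) F (upd x v t%:Z).
    apply: eq_bigl => t; apply: eq_forallb => i; rewrite aff_upd// /w.
    case: (eqVneq (D i v) 0) => [->|Di]; first by rewrite mul0r addr0.
    by rewrite bndE (tight_row _ _ _ (D2 i Di)).
  have pE i : D i v != 0 -> holds N (pivot N D i v) x =
     [forall i', if D i' v == 0 then 0 <= w i' else
       0 <= D i' v * (w i - w i') - ((D i' v == D i v) && (i' < i)%N)%:R].
    move=> Di; apply: eq_forallb => i'; rewrite aff_pivot /w (negbTE Di).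
    case: (eqVneq (D i' v) 0) => [->|Di'].
      by rewrite mulr0 mul0r subr0 eq_sym (negbTE Di) subr0.
    rewrite !bndE; congr (0 <= _ - _).
    by rewrite -(tight_row _ _ _ (D2 i' Di')); ring.
  move=> ->; rewrite -sumrN; congr (_ + _).
  + rewrite -big_mkcondr; apply: eq_big => [i|i /andP[/eqP e _]]; last by rewrite /w e.
    by case: eqP => //= e; rewrite pE ?e.
  + rewrite -big_mkcondr; apply: eq_big => [i|i /andP[/eqP e _]].
      by case: eqP => //= e; rewrite pE ?e.
    by rewrite /w e mulN1r bnd'E.
- by apply: (pwpoly_ext (pwpoly_zero _ _ _ _ _ _)) => x; rewrite /sum_var big1.
- move=> F G _ IHF _ IHG; apply: (pwpoly_ext (pwpoly_add IHF IHG)) => x.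
  by rewrite /sum_var big_split.
- move=> F G _ IHF FG; apply: (pwpoly_ext IHF) => x.
  by apply: eq_bigr => t _; rewrite FG.
Qed.

(* Variable [0] is summed innermost, as in [iter_int]. *)
Fixpoint iter_sum (R : nmodType) (Bd : (nat -> int) -> nat) (n : nat)
    (H : (nat -> int) -> R) : (nat -> int) -> R :=
  match n with
  | 0 => H
  | j.+1 => sum_var Bd j (iter_sum Bd j H)
  end.

Lemma pwpoly_iter_sum (R : numFieldType) N m up n d (H : (nat -> int) -> R) :
  (n <= N)%N -> (forall v, (v < n)%N -> up v = 0) ->
  pwpoly N m up (iota 0 n) d H -> pwpoly N m up [::] (n + d) (iter_sum (box_bound N up) n H).
Proof.
move=> nN up0 PH.
suff K j : (j <= n)%N -> pwpoly N m up (iota j (n - j)) (j + d) (iter_sum (box_bound N up) j H).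
  by have := K n (leqnn n); rewrite subnn.
elim: j => [|j IH] jn; first by rewrite subn0.
have := IH (ltnW jn); rewrite (_ : (n - j)%N = (n - j.+1).+1); last by lia.
move=> /= K; rewrite addSn; apply: pwpoly_sum_var K.
- by lia.
- by rewrite mem_iota; lia.
- by rewrite mem_iota; lia.
- exact: up0.
Qed.

Lemma affine_eventually (a c : int) :
  exists (K : int) (b : bool), forall k, K <= k -> (0 <= a * k + c) = b.
Proof.
case: (ltgtP a 0) => a0.
- by exists (`|c| + 1), false => k hk; apply/negbTE; rewrite -ltNge; nia.
- by exists `|c|, true => k hk; nia.
- by exists 0, (0 <= c) => k _; rewrite a0 mul0r add0r.
Qed.

Lemma pwpoly_poly (R : numFieldType) N m up d (H : (nat -> int) -> R) v x : (v < N)%N ->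
  pwpoly N m up [::] d H -> exists2 p : {poly R}, (size p <= d.+1)%N &
    exists K : int, forall k, K <= k -> H (upd x v k) = p.[k%:~R].
Proof.
move=> vN; elim=> {H}.
- move=> D F _ _ HF; have [p sp pE] := polyfun_poly x vN HF.
  have [K [b Kb]] : exists (K : int) (b : bool),
      forall k, K <= k -> holds N D (upd x v k) = b.
    have hE k : holds N D (upd x v k) = all (fun i => 0 <= aff N (D i) (upd x v k)) (enum 'I_m).
      by apply/forallP/allP => h i; [|apply: h; rewrite mem_enum].
    have [K [b Kb]] : exists (K : int) (b : bool), forall k, K <= k ->
       all (fun i => 0 <= aff N (D i) (upd x v k)) (enum 'I_m) = b.
      elim: (enum 'I_m) => [|i r [K [b Kb]]]; first by exists 0, true.
      have [K' [b' Kb']] := affine_eventually (D i v) (aff N (D i) x - D i v * x v).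
      exists (Num.max K K'), (b' && b) => k; rewrite ge_max => /andP[k1 k2] /=.
      rewrite Kb// aff_upd// -(Kb' k)//; congr ((0 <= _) && _); ring.
    by exists K, b => k kK; rewrite hE Kb.
  case: b Kb => Kb; first by exists p => //; exists K => k /Kb ->.
  by exists 0; rewrite ?size_poly0//; exists K => k /Kb ->; rewrite horner0.
- by exists 0; rewrite ?size_poly0//; exists 0 => k _; rewrite horner0.
- move=> F G _ [p sp [K pE]] _ [q sq [L qE]]; exists (p + q).
    by rewrite (leq_trans (size_polyD _ _))// geq_max sp.
  exists (Num.max K L) => k; rewrite ge_max => /andP[k1 k2].
  by rewrite pE// qE// hornerD.
- by move=> F G _ [p sp [K pE]] FG; exists p => //; exists K => k /pE <-.
Qed.

(** * Iterated sums, lattice point counts and iterated integrals *)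

Lemma iter_sum_bound (V : nmodType) (Bd : (nat -> int) -> nat) n (H : (nat -> int) -> V) x :
  (forall y v t, (v < n)%N -> Bd (upd y v t) = Bd y) ->
  iter_sum Bd n H x = iter_sum (fun=> Bd x) n H x.
Proof.
elim: n x => [//|n IH] x BdE; rewrite /= /sum_var; apply: eq_bigr => t _.
rewrite IH ?BdE// => y v s vn; apply: BdE; exact: ltnW.
Qed.

Definition overwrite n B (w : {ffun 'I_n -> 'I_B}) (x : nat -> int) : nat -> int :=
  fun j => if insub j is Some i then (w i)%:Z else x j.

Lemma iter_sum_ffun (V : nmodType) (B n : nat) (H : (nat -> int) -> V) x :
  iter_sum (fun=> B) n H x = \sum_(w : {ffun 'I_n -> 'I_B}) H (overwrite w x).
Proof.
elim: n x => [|n IH] x.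
  have e (w : {ffun 'I_0 -> 'I_B}) : overwrite w x = x.
    by apply/funext => j; rewrite /overwrite insubF.
  under eq_bigr do rewrite e.
  by rewrite sumr_const card_ffun !card_ord expn0.
transitivity (\sum_(t < B) \sum_(w : {ffun 'I_n -> 'I_B}) H (overwrite w (upd x n t%:Z))).
  by apply: eq_bigr => t _; exact: IH.
rewrite pair_big /=.
(* The outermost summation index becomes the last coordinate. *)
pose F (p : 'I_B * {ffun 'I_n -> 'I_B}) : {ffun 'I_n.+1 -> 'I_B} :=
  [ffun i => if unlift ord_max i is Some i' then p.2 i' else p.1].
pose G (w : {ffun 'I_n.+1 -> 'I_B}) : 'I_B * {ffun 'I_n -> 'I_B} :=
  (w ord_max, [ffun i => w (lift ord_max i)]).
rewrite [RHS](reindex F) /=; last first.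
  exists G => [[t w] _|w _].
    rewrite /G /F ffunE unlift_none /=; congr pair.
    by apply/ffunP => i; rewrite !ffunE liftK.
  apply/ffunP => i; rewrite /G /F ffunE /=.
  by case: unliftP => [i' ->|->] //; rewrite ffunE.
apply: eq_bigr => -[t w] _ /=; congr H; apply/funext => j.
rewrite /overwrite /upd.
case: (ltngtP j n) => jn.
- rewrite (insubT (fun i => i < n)%N jn) (insubT (fun i => i < n.+1)%N (ltnW jn)) /= ffunE.
  case: unliftP => [i' /(congr1 val)|/(congr1 val)] /=; last by lia.
  by rewrite /bump; case: leqP => //= h e; [|congr (w _)%:Z; exact: val_inj]; have := ltn_ord i'; lia.
- by rewrite !insubF//; lia.
- subst j; rewrite insubF ?ltnn// (insubT (fun i => i < n.+1)%N (ltnSn n)) /= ffunE.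
  case: unliftP => [i' /(congr1 val)|//] /=.
  by move=> e; exfalso; have := ltn_ord i'; move: e; rewrite /bump; case: leqP => /=; rewrite ?add0n ?add1n; lia.
Qed.

Definition bvec n (z : nat -> int) : 'cV[int]_n := \col_(j < n) z j.

Lemma bvec_overwrite n B (w : {ffun 'I_n -> 'I_B}) x :
  bvec n (overwrite w x) = \col_j (w j)%:Z.
Proof.
by apply/matrixP => i j; rewrite !mxE /overwrite insubT//= => h; congr (w _)%:Z; exact: val_inj.
Qed.

Section box.
Context (n B : nat) (S : set 'cV[int]_n).
Hypothesis SB : forall z, S z -> forall j, 0 <= z j 0 < B%:Z.

Let img : S = [set \col_j (w j)%:Z | w in [set w : {ffun 'I_n -> 'I_B} | S (\col_j (w j)%:Z)]].
Proof.
apply/seteqP; split => [z Sz|_ [w Sw <-]] //=.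
have zB j : (absz (z j 0%R) < B)%N by have := SB Sz j; case: (z j 0) => //= a; lia.
pose w : {ffun 'I_n -> 'I_B} := [ffun j => Ordinal (zB j)].
have wz : \col_j (w j)%:Z = z.
  apply/matrixP => i j; rewrite !mxE ffunE /= (ord1 j).
  by rewrite gez0_abs//; have /andP[] := SB Sz i.
by exists w; rewrite wz.
Qed.

Lemma finite_box : finite_set S.
Proof. by rewrite img; apply: finite_image; exact: finite_finset. Qed.

Lemma card_box (R : pzSemiRingType) x : #|` fset_set S|%:R =
  iter_sum (fun=> B) n (fun z => if `[< S (bvec n z) >] then 1 else 0 : R) x.
Proof.
rewrite iter_sum_ffun; under eq_bigr do rewrite bvec_overwrite.
rewrite -big_mkcond /= sumr_const; congr (_ *+ _).
pose P := [pred w : {ffun 'I_n -> 'I_B} | `[< S (\col_j (w j)%:Z) >]].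
pose F (w : {ffun 'I_n -> 'I_B}) : 'cV[int]_n := \col_j (w j)%:Z.
have -> : fset_set S = [fset F w | w in P]%fset.
  apply/fsetP => z; rewrite in_fset_set; last exact: finite_box.
  apply/idP/imfsetP => /= [|[w + ->]].
    rewrite inE {1}img => -[w Sw <-]; exists w => //.
    by rewrite unfold_in /=; exact: asboolT.
  by rewrite unfold_in /= => /asboolW Sw; apply/mem_set.
rewrite card_in_imfset /=.
  by rewrite -cardE.
move=> w w' _ _ /matrixP e; apply/ffunP => j; have := e j ord0; rewrite !mxE => -[].
exact: val_inj.
Qed.
End box.

(** The integral of a nonnegative function is a supremum over simple functions below it, so
    monotonicity holds for arbitrary functions. This spares a proof that the partial integrals in
    [iter_int] are measurable. *)
Lemma ge0_le_lower_integral d (T : measurableType d) (R : realType)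
    (mu : {measure set T -> \bar R}) (f g : T -> \bar R) :
  (forall x, 0 <= f x)%E -> (forall x, f x <= g x)%E ->
  (\int[mu]_x f x <= \int[mu]_x g x)%E.
Proof.
move=> f0 fg; rewrite !ge0_integralTE//; last first.
  by move=> x; exact: le_trans (f0 x) (fg x).
apply: le_ereal_sup => _ [h hf <-]; exists h => //= x.
exact: le_trans (hf x) (fg x).
Qed.

Lemma iter_int_ge0 (R : realType) n (g : (nat -> R) -> \bar R) x :
  (forall y, 0 <= g y)%E -> (0 <= iter_int n g x)%E.
Proof. by move=> g0; elim: n x => [|n IH] x //=; apply: integral_ge0. Qed.

Lemma le_iter_int (R : realType) n (f g : (nat -> R) -> \bar R) x :
  (forall y, 0 <= f y)%E -> (forall y, f y <= g y)%E ->
  (iter_int n f x <= iter_int n g x)%E.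
Proof.
move=> f0 fg; elim: n x => [|n IH] x //=.
by apply: ge0_le_lower_integral => t //; exact: iter_int_ge0.
Qed.

(** The integrand is a step function, constant on the intervals from [z / k] to [(z + 1) / k], each
    of length [1 / k]. *)
Lemma integral_floor (R : realType) (phi : int -> R) (B : nat) (k : nat) : (0 < k)%N ->
  (forall z, 0 <= phi z) -> (forall z, ~~ (0 <= z < B%:Z) -> phi z = 0) ->
  (\int[@lebesgue_measure R]_(t in [set: R]) (phi (Num.floor (k%:R * t)))%:E =
   (k%:R^-1 * \sum_(z < B) phi z%:Z)%:E)%E.
Proof.
move=> k0 phi0 phiB.
have kR : 0 < k%:R :> R by rewrite ltr0n.
pose I (z : nat) : set R := [set` `[(z%:R / k%:R : R), z.+1%:R / k%:R[ ].
have IE z t : (Num.floor (k%:R * t) == z%:Z) = (t \in I z).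
  rewrite floor_eq mem_setE /I in_itv /= ler_pdivrMr// ltr_pdivlMr// mulrC.
  by congr (_ && (_ < _)); rewrite -natr1 intrD.
have e t : (phi (Num.floor (k%:R * t)))%:E =
    (\sum_(z <- index_enum 'I_B) (phi z%:Z)%:E * (\1_(I z) t)%:E)%E.
  set f := Num.floor _.
  case: (boolP (0 <= f < B%:Z)) => [/andP[f0 fB]|fB].
    have zB : (absz f < B)%N by lia.
    rewrite (bigD1 (Ordinal zB)) //= big1 ?adde0.
      rewrite indicE -IE -/f gez0_abs// eqxx mule1; congr (phi _)%:E; lia.
    move=> z zf; rewrite indicE -IE -/f; case: eqP => [fz|_]; last by rewrite mule0.
    by case/eqP: zf; apply/val_inj => /=; lia.
  rewrite phiB// big1// => z _; rewrite indicE -IE -/f; case: eqP => [fz|_]; last by rewrite mule0.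
  by have := ltn_ord z; move: fB; lia.
have mI z : measurable (I z) by exact: measurable_itv.
have mIE z : (@lebesgue_measure R (I z) = (k%:R^-1)%:E)%E.
  rewrite /I lebesgue_measure_itv /= lte_fin ltr_pM2r ?invr_gt0// ltr_nat ltnSn.
  by rewrite -EFinB -mulrBl -natr1 addrAC subrr add0r mul1r.
under eq_integral do rewrite e.
rewrite ge0_integral_sum//; last 2 first.
- move=> z; apply: measurable_funeM; apply/measurable_EFinP; apply: measurable_indic; exact: mI.
- by move=> z t _; rewrite mule_ge0// lee_fin.
rewrite mulr_sumr -sumEFin; apply: eq_bigr => z _.
rewrite ge0_integralZl//; last 2 first.
- by apply/measurable_EFinP; apply: measurable_indic; exact: mI.
- by rewrite lee_fin.
rewrite (integral_indic _ measurableT); last exact: mI.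
by rewrite setIT [X in (_ * X)%E]mIE -EFinM mulrC.
Qed.

(** Supplies the vanishing outside the box that [integral_floor] asks of the inner sum. *)
Lemma iter_sum_out (V : nmodType) (B j : nat) (H : (nat -> int) -> V) z i :
  (j <= i)%N -> (forall z, ~~ (0 <= z i < B%:Z) -> H z = 0) ->
  ~~ (0 <= z i < B%:Z) -> iter_sum (fun=> B) j H z = 0.
Proof.
move=> ji H0; elim: j z ji => [|j IH] z ji zi /=; first exact: H0.
rewrite /sum_var big1// => t _; apply: IH; first exact: ltnW.
by rewrite /upd gtn_eqF.
Qed.

Lemma iter_int_floor (R : realType) (n B k : nat) (h : (nat -> int) -> R) x : (0 < k)%N ->
  (forall z, 0 <= h z) ->
  (forall z i, (i < n)%N -> ~~ (0 <= z i < B%:Z) -> h z = 0) ->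
  iter_int n (fun y => (h (fun i => Num.floor (k%:R * y i)))%:E) x =
  (k%:R ^- n * iter_sum (fun=> B) n h (fun i => Num.floor (k%:R * x i)))%:E.
Proof.
move=> k0 h0 hB.
have s0 j z : 0 <= iter_sum (fun=> B) j h z.
  by elim: j z => [|j IH] z //=; apply: sumr_ge0 => t _.
suff: forall j y, (j <= n)%N -> iter_int j (fun y => (h (fun i => Num.floor (k%:R * y i)))%:E) y =
  (k%:R ^- j * iter_sum (fun=> B) j h (fun i => Num.floor (k%:R * y i)))%:E by exact.
elim=> [|j IH] y jn; first by rewrite /= expr0 invr1 mul1r.
rewrite /=; under eq_integral do rewrite IH ?(ltnW jn)//.
pose phi (t : int) := k%:R ^- j *
  iter_sum (fun=> B) j h (upd (fun i => Num.floor (k%:R * y i)) j t).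
rewrite -[LHS]/(integral _ _ _).
transitivity (\int[@lebesgue_measure R]_(t in [set: R]) (phi (Num.floor (k%:R * t)))%:E)%E.
  apply: eq_integral => t _; congr (_ * iter_sum _ _ _ _)%:E.
  by apply/funext => i; rewrite /upd; case: ifP.
rewrite (@integral_floor _ _ B)//.
- by rewrite /phi -mulr_sumr mulrA exprS invfM.
- by move=> t; rewrite /phi mulr_ge0// invr_ge0 exprn_ge0.
- move=> t tB; rewrite /phi (@iter_sum_out _ _ _ _ _ j) ?mulr0//.
    by move=> z; exact: hB.
  by rewrite /upd eqxx.
Qed.

(** * Counting lattice points of dilated polyhedra *)

Local Notation intmx := (map_mx (fun a : int => a%:~R)).

Lemma Ppoly_bounded (R : realType) m n (A : 'M[R]_(m, n)) b :
  bounded_set (Ppoly A b) -> exists M0 : R, forall x j, Ppoly A b x -> x j 0 <= M0.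
Proof.
move=> [M [_ MP]]; exists (M + 1) => x j Px.
have M1 : M < M + 1 by rewrite ltrDl.
have /= xM := MP _ M1 x Px.
apply: le_trans xM; apply: le_trans (ler_norm _) _.
rewrite [leRHS]mx_normrE.
exact: (le_bigmax _ (fun ij => `|x ij.1 ij.2|) (j, 0)).
Qed.

Lemma sign01M d e : sign01 d -> sign01 e -> sign01 (d * e).
Proof.
by move=> [->|[->|->]] [->|[->|->]];
  rewrite ?mul0r ?mulr0 ?mul1r ?mulr1 ?mulrNN /sign01; tauto.
Qed.

Lemma sign01X k : sign01 ((-1) ^+ k).
Proof. by rewrite -signr_odd; case: odd; rewrite ?expr0 ?expr1 /sign01; tauto. Qed.

(** Laplace expansion along a row that is a signed unit vector or zero reduces to a smaller minor,
    so only minors avoiding such rows have to be checked. *)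
Lemma TU_on_unit_rows (I : Type) (s : seq nat) (D : I -> nat -> int) (U : pred I) :
  (forall i, U i -> exists v e, sign01 e /\ forall u, u \in s -> D i u = e * coordf v u) ->
  (forall (k : nat) (f : 'I_k -> I) (g : 'I_k -> nat), injective f -> injective g ->
     (forall i, g i \in s) -> (forall i, ~~ U (f i)) ->
     sign01 (\det (\matrix_(i, j) D (f i) (g j)))) ->
  TU_on s D.
Proof.
move=> DU DN; elim=> [|k IH] f g fI gI gs; first by apply: DN => // -[].
case: (pickP (fun a => U (f a))) => [a Ua|nU]; last first.
  by apply: DN => // i; rewrite nU.
have [v [e [se De]]] := DU _ Ua.
rewrite (expand_det_row _ a).
case: (pickP (fun j => g j == v)) => [j0 /eqP gj0|nv]; last first.
  by left; rewrite big1// => j _; rewrite mxE De// /coordf nv mulr0 mul0r.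
rewrite (bigD1 j0) //= big1 ?addr0; last first.
  move=> j jj0; rewrite mxE De// /coordf -gj0.
  have -> : (g j == g j0) = false by apply: contraNF jj0 => /eqP/gI ->.
  by rewrite mulr0 mul0r.
rewrite mxE De// /coordf gj0 eqxx mulr1; apply: sign01M => //.
rewrite /cofactor; apply: sign01M; first exact: sign01X.
rewrite (_ : row' _ _ = \matrix_(i, j) D (f (lift a i)) (g (lift j0 j))).
  apply: IH => [x y /fI/lift_inj//|x y /gI/lift_inj//|i]; exact: gs.
by apply/matrixP => i j; rewrite !mxE.
Qed.

(** The minors of size one force the entries to be 0, 1 or -1, so floors lose nothing; larger minors
    transfer along the injection of the integers. *)
Lemma TU_int (R : realType) m n (A : 'M[R]_(m, n)) : totally_unimodular A ->
  exists2 A0 : 'M[int]_(m, n), A = intmx A0 &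
    forall k (f : 'I_k -> 'I_m) (g : 'I_k -> 'I_n), injective f -> injective g ->
    sign01 (\det (mxsub f g A0)).
Proof.
move=> TUA.
have AE : A = intmx (map_mx Num.floor A).
  apply/matrixP => i j; rewrite !mxE.
  have := TUA 1%N (fun=> i) (fun=> j).
  rewrite det_mx11 mxE => /(_ _ _)[x y|x y|->|[->|->]]; rewrite ?(ord1 x) ?(ord1 y)//.
  - by rewrite floor0.
  - by rewrite floor1.
  - by rewrite -[-1](intrN _ 1) intrKfloor.
exists (map_mx Num.floor A) => // k f g fI gI.
have := TUA k f g fI gI.
rewrite [in \det _]AE (_ : mxsub f g (intmx _) = intmx (mxsub f g (map_mx Num.floor A))); last first.
  by apply/matrixP => i j; rewrite !mxE.
rewrite det_map_mx; move: (\det _) => d /= [|[|]] /eqP.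
- by rewrite intr_eq0 => /eqP; left.
- by rewrite -[1]/(1%:~R) eqr_int => /eqP; right; left.
- by rewrite -[-1](intrN _ 1) eqr_int => /eqP; right; right.
Qed.

Lemma TU_entry (R : realType) m n (A : 'M[R]_(m, n)) i j :
  totally_unimodular A -> `|A i j| <= 1.
Proof.
move=> TUA; have := TUA 1%N (fun=> i) (fun=> j).
rewrite det_mx11 mxE => /(_ _ _)[x y|x y|->|[->|->]]; rewrite ?(ord1 x) ?(ord1 y)//.
- by rewrite normr0.
- by rewrite normr1.
- by rewrite normrN1.
Qed.

Lemma int_points_bounded (R : realType) m n (A : 'M[R]_(m, n)) (b c : 'cV[int]_m) :
  bounded_set (Ppoly A (intmx b)) ->
  exists M M' K : int, forall k : int, K <= k ->
    forall z, int_points A (intmx (k *: b + c)) z -> forall j, 0 <= z j 0 <= M * k + M'.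
Proof.
move=> /Ppoly_bounded[M0 PM0].
have /choice[F FP] : forall j : 'I_n, exists q : R * R * R,
    forall (k : R) (x : 'cV[R]_n), q.2 <= k ->
    (forall i, (A *m x) i 0 <= k * intmx b i 0 + intmx c i 0) -> (forall i, 0 <= x i 0) ->
    x j 0 <= q.1.1 * k + q.1.2.
  move=> j; have [M [M' [K H]]] := @dilation_bound R m n A (intmx b) (intmx c) M0 j
    (fun x xA x0 => PM0 x j (conj xA x0)).
  by exists (M, M', K).
(* One integer above all the [h j], making the bounds uniform in [j]. *)
pose S (h : 'I_n -> R) : int := Num.ceil (\sum_j `|h j|).
have S_ge h j : h j <= (S h)%:~R.
  apply: le_trans (ceil_ge _); apply: le_trans (ler_norm _) _.
  by rewrite (bigD1 j)//= lerDl sumr_ge0.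
exists (S (fun j => (F j).1.1)), (S (fun j => (F j).1.2)),
  (Num.max 0 (S (fun j => (F j).2))) => k.
rewrite ge_max => /andP[k0 kK] z [zA z0] j.
have := z0 j; rewrite mxE ler0z => -> /=.
have : (intmx z : 'cV[R]_n) j 0 <= (F j).1.1 * k%:~R + (F j).1.2.
  apply: FP => //; first by apply: le_trans (S_ge (fun j => (F j).2) j) _; rewrite ler_int.
  by move=> i; have := zA i; rewrite !mxE intrD intrM.
rewrite mxE -(ler_int R) intrD intrM => /le_trans; apply; apply: lerD.
  by rewrite ler_wpM2r ?ler0z// (S_ge (fun j => (F j).1.1)).
exact: (S_ge (fun j => (F j).1.2)).
Qed.

Section lattice_points_polynomial.
Context (R : realType) (m n : nat) (A : 'M[R]_(m, n)) (b c : 'cV[int]_m).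
Context (A0 : 'M[int]_(m, n)) (M M' : int).
Hypothesis AE : A = intmx A0.
Hypothesis TUA : forall k (f : 'I_k -> 'I_m) (g : 'I_k -> 'I_n),
  injective f -> injective g -> sign01 (\det (mxsub f g A0)).

(* Slot [n] holds the dilation factor and slot [n.+1] the constant term. *)
Let N := n.+1.

Let row_of (i : 'I_m) : nat -> int := fun l =>
  if insub l is Some l' then - A0 i l' else if l == n then b i 0 else c i 0.

Let up : nat -> int := fun l => if (l < n)%N then 0 else if l == n then M else M'.

(** The inequalities of the system, followed by [n] lower and [n] upper box rows. The box rows are
    consequences of the bound [M * k + M'], so they do not change the set of lattice points. *)
Let D (i : 'I_(m + (n + n))) : nat -> int :=
  match fintype.split i with
  | inl i => row_of i
  | inr j => match fintype.split j with
             | inl v => coordf v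
             | inr v => fun l => up l - coordf v l
             end
  end.

Let DTU : TU_on (iota 0 n) D.
Proof.
apply: (@TU_on_unit_rows _ _ _ (fun i => if fintype.split i is inr _ then true else false)).
  move=> i; rewrite /D; case: (fintype.split i) => // j _.
  case: (fintype.split j) => v; exists v.
    by exists 1; split; [rewrite /sign01; tauto|move=> u _; rewrite mul1r].
  exists (-1); split; first by rewrite /sign01; tauto.
  by move=> u; rewrite mem_iota /up /= => ->; rewrite mulN1r sub0r.
move=> k f g fI gI gs fU.
have fl a : exists i, f a = lshift (n + n) i.
  by have := fU a; case: splitP => // i e _; exists i; exact: val_inj.
have gl a : exists j : 'I_n, g a = j.
  by have := gs a; rewrite mem_iota /= add0n => h; exists (Ordinal h).
have [f' f'E] := choice fl; have [g' g'E] := choice gl.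
have -> : \matrix_(i, j) D (f i) (g j) = -1 *: mxsub f' g' A0.
  apply/matrixP => i j; rewrite !mxE f'E g'E /D.
  rewrite -[lshift _ _]/(unsplit (inl _)) unsplitK /row_of insubT//= => h.
  by rewrite mulN1r; congr (- A0 _ _); exact: val_inj.
rewrite detZ; apply: sign01M; first exact: sign01X.
apply: TUA => x y e.
  by apply: fI; rewrite !f'E e.
by apply: gI; rewrite !g'E e.
Qed.

Let Dbox : boxed up (iota 0 n) D.
Proof.
move=> v; rewrite mem_iota /= add0n => vn; split.
  exists (unsplit (inr (unsplit (inl (Ordinal vn))))) => l.
  by rewrite /D !unsplitK.
exists (unsplit (inr (unsplit (inr (Ordinal vn))))) => l.
by rewrite /D !unsplitK.
Qed.

Let row_ofE i x : aff N (row_of i) x =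
  b i 0 * x n + c i 0 - \sum_(l < n) A0 i l * x l.
Proof.
rewrite /aff big_ord_recr /= /row_of !insubF ?ltnn ?ltnNge ?leqnSn//.
rewrite eqxx [n.+1 == n]gtn_eqF// -addrA addrC -sumrN; congr (_ + _).
apply: eq_bigr => l _; rewrite insubT// => h; rewrite mulNr.
by congr (- (A0 _ _ * _)); exact: val_inj.
Qed.

Let upE x : aff N up x = M * x n + M'.
Proof.
rewrite /aff big_ord_recr /= /up ltnn eqxx [n.+1 == n]gtn_eqF// ltnNge leqnSn /=.
by rewrite big1 ?add0r// => l _; rewrite ltn_ord mul0r.
Qed.

Let S (k : int) := int_points A (intmx (k *: b + c)).

Let holdsE (k : int) (y : nat -> int) : y n = k ->
  (forall z, S k z -> forall j, 0 <= z j 0 <= M * k + M') ->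
  holds N D y = `[< S k (bvec n y) >].
Proof.
move=> yk SB.
have SE : S k (bvec n y) <-> (forall i, \sum_(l < n) A0 i l * y l <= k * b i 0 + c i 0) /\
                    (forall j : 'I_n, 0 <= y j).
  split=> -[H1 H2]; split => i.
  - have := H1 i; rewrite AE -map_mxM !mxE ler_int; apply: le_trans.
    by rewrite le_eqVlt; apply/orP; left; apply/eqP/eq_bigr => l _; rewrite mxE.
  - by have := H2 i; rewrite !mxE ler0z.
  - rewrite AE -map_mxM !mxE ler_int; apply: le_trans (H1 i).
    by rewrite le_eqVlt; apply/orP; left; apply/eqP/eq_bigr => l _; rewrite mxE.
  - by rewrite !mxE ler0z.
apply/forallP/asboolP => [H|/[dup] /SB SBy /SE[H1 H2] i].
  apply/SE; split => [i|j].
    have := H (unsplit (inl i)); rewrite /D unsplitK row_ofE yk mulrC; lia.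
  by have := H (unsplit (inr (unsplit (inl j)))); rewrite /D !unsplitK aff_coordf// ltnS ltnW.
rewrite /D; case: (fintype.split i) => [i'|j].
  by rewrite row_ofE yk mulrC; have := H1 i'; lia.
case: (fintype.split j) => v; first by rewrite aff_coordf// ltnS ltnW.
rewrite (@eq_aff N _ (fun l => up l + (-1) * coordf v l)); last by move=> l; rewrite mulN1r.
rewrite affD affZ upE aff_coordf ?ltnS 1?ltnW// yk.
by have := SBy v; rewrite mxE; lia.
Qed.

Lemma Npts_poly (K : int) :
  (forall k : int, K <= k ->
    forall z, int_points A (intmx (k *: b + c)) z -> forall j, 0 <= z j 0 <= M * k + M') ->
  exists2 f : {poly R}, (size f <= n.+1)%N &
    exists K' : int, forall k : int, K' <= k ->
      (Npts A (intmx (k *: b + c)))%:R = f.[k%:~R].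
Proof.
move=> SB.
have up0 v : (v < n)%N -> up v = 0 by rewrite /up => ->.
have P0 : pwpoly N (m + (n + n)) up (iota 0 n) 0 (fun x => if holds N D x then 1 else 0 : R).
  by apply: pwpoly_term => //; exact: polyfun_const.
(* The summand has degree 0 and each of the [n] summations raises the degree by one. *)
have [f sf [K1 fE]] := pwpoly_poly (fun=> 0) (ltnSn n) (pwpoly_iter_sum (leqnSn n) up0 P0).
exists f; first by rewrite addn0 in sf.
exists (Num.max K K1) => k; rewrite ge_max => /andP[kK kK1].
rewrite -fE// iter_sum_bound; last first.
  by move=> y v t vn; rewrite /box_bound aff_upd ?ltnS 1?ltnW// up0// mul0r addr0.
set x := upd _ _ _; set B := box_bound _ _ _.
have xn : x n = k by rewrite /x /upd eqxx.
rewrite /Npts (@card_box n B _ _ R x); last first.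
  by move=> z /(SB k kK z) + j => /(_ j); rewrite /B /box_bound upE xn; lia.
rewrite !iter_sum_ffun; apply: eq_bigr => w _.
rewrite (@holdsE k)//; first by rewrite /overwrite insubF ?ltnn.
exact: SB.
Qed.

End lattice_points_polynomial.

(** * Comparison with the volume *)

Lemma int_points_boxed (R : realType) m n (A : 'M[R]_(m, n)) (b c : 'cV[int]_m) :
  bounded_set (Ppoly A (intmx b)) ->
  exists K : int, forall k : int, K <= k -> exists B : nat,
    forall z, int_points A (intmx (k *: b + c)) z -> forall j, 0 <= z j 0 < B%:Z.
Proof.
move=> /(int_points_bounded c)[M [M' [K H]]]; exists K => k kK.
exists (absz (M * k + M')).+1 => z Sz j; have := H k kK z Sz j.
by move: (M * k + M') (z j 0) => a e; lia.
Qed.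

Lemma leq_card_injection (T : choiceType) (S S' : set T) (f : T -> T) :
  injective f -> finite_set S -> finite_set S' -> (forall z, S z -> S' (f z)) ->
  (#|` fset_set S| <= #|` fset_set S'|)%N.
Proof.
move=> fI fS fS' SS'.
have <- : #|` [fset f x | x in fset_set S]%fset| = #|` fset_set S| by rewrite card_imfset.
apply: fsubset_leq_card.
apply/fsubsetP => z /imfsetP[y + ->].
by rewrite /= !in_fset_set// !inE; exact: SS'.
Qed.

(** Rounding moves each coordinate by less than 1 and the entries have absolute value at most 1, so
    a row changes by at most the number of columns. *)
Lemma floor_row (R : realType) m n (A : 'M[R]_(m, n)) (x : 'cV[R]_n) i :
  totally_unimodular A ->
  `|(A *m x) i 0 - (A *m intmx (map_mx Num.floor x)) i 0| <= n%:R.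
Proof.
move=> TUA; rewrite !mxE -sumrB; apply: le_trans (ler_norm_sum _ _ _) _.
rewrite -[n in n%:R]card_ord -sum1_card natr_sum; apply: ler_sum => j _.
rewrite -mulrBr normrM mulr_ile1//; first exact: TU_entry.
rewrite !mxE; have /andP[h1 h2] := floor_itv (x j 0); rewrite intrD in h2.
by rewrite ger0_norm; lra.
Qed.

Section volume_sandwich.
Context (R : realType) (m n : nat) (A : 'M[R]_(m, n)) (b : 'cV[int]_m).
Hypothesis TUA : totally_unimodular A.

Let indic_floor (S : set 'cV[int]_n) (k : nat) (x : nat -> R) : R :=
  if `[< S (map_mx Num.floor (k%:R *: vec_of n x)) >] then 1 else 0.

Let iter_int_count (S : set 'cV[int]_n) (B k : nat) x : (0 < k)%N ->
  (forall z, S z -> forall j, 0 <= z j 0 < B%:Z) ->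
  iter_int n (fun y => (indic_floor S k y)%:E) x = (k%:R ^- n * #|` fset_set S|%:R)%:E.
Proof.
move=> k0 SB.
rewrite (card_box SB R (fun i => Num.floor (k%:R * x i))) -iter_int_floor//.
- congr iter_int; apply/funext => y; rewrite /indic_floor.
  suff -> : map_mx Num.floor (k%:R *: vec_of n y) =
    bvec n (fun i => Num.floor (k%:R * y i)) by [].
  by apply/matrixP => i j; rewrite !mxE.
- by move=> z; case: ifP.
- move=> z i ni zi; case: asboolP => // /SB/(_ (Ordinal ni)).
  by rewrite mxE /= (negbTE zi).
Qed.

Let scaleP (k : nat) (y : 'cV[R]_n) i : (A *m (k%:R *: y)) i 0 = k%:R * (A *m y) i 0.
Proof. by rewrite -scalemxAr mxE. Qed.

Variables (C : int) (k : nat).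
Hypotheses (nC : n%:Z <= C) (k0 : (0 < k)%N).

Let nCR : n%:R <= C%:~R :> R.
Proof. by rewrite (ler_int R n C). Qed.

Let kR : 0 < k%:R :> R. Proof. by rewrite ltr0n. Qed.

(** If the floor of [k x] satisfies the system with right-hand side [k b - C], the rounding error,
    at most [n <= C], leaves [k x] in the dilate by [k]. The indicator of the rounded condition
    integrates to the count divided by [k ^ n]. The lemma [volume_le] reverses this. *)
Lemma volume_ge (B : nat) :
  (forall z, int_points A (intmx (k%:Z *: b + const_mx (- C))) z ->
     forall j, 0 <= z j 0 < B%:Z) ->
  ((k%:R ^- n * (Npts A (intmx (k%:Z *: b + const_mx (- C))))%:R)%:E <=
   volume (Ppoly A (intmx b)))%E.
Proof.
move=> SB; rewrite /Npts -(iter_int_count (fun=> 0) k0 SB) /volume.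
apply: le_iter_int => y; first by rewrite lee_fin /indic_floor; case: ifP.
rewrite lee_fin /indic_floor; case: asboolP => [[SA S0]|_]; last by case: ifP.
rewrite asboolT//; split => [i|j].
  rewrite -(ler_pM2l kR); have := SA i.
  have := floor_row (k%:R *: vec_of n y) i TUA; have := nCR.
  by rewrite scaleP !mxE ler_norml intrD intrM intrN -pmulrn => h1 /andP[_ h2] h3; lra.
have := S0 j; rewrite !mxE ler0z floor_ge0 pmulr_rge0//.
Qed.

Lemma volume_le (B : nat) :
  (forall z, int_points A (intmx (k%:Z *: b + const_mx C)) z ->
     forall j, 0 <= z j 0 < B%:Z) ->
  (volume (Ppoly A (intmx b)) <=
   (k%:R ^- n * (Npts A (intmx (k%:Z *: b + const_mx C)))%:R)%:E)%E.
Proof.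
move=> SB; rewrite /Npts -(iter_int_count (fun=> 0) k0 SB) /volume.
apply: le_iter_int => y; first by rewrite lee_fin; case: ifP.
rewrite lee_fin /indic_floor; case: asboolP => [[PA P0]|_]; last by case: ifP.
rewrite asboolT//; split => [i|j].
  have := PA i; rewrite -(ler_pM2l kR).
  have := floor_row (k%:R *: vec_of n y) i TUA; have := nCR.
  by rewrite scaleP !mxE ler_norml intrD intrM -pmulrn => h1 /andP[h2 _] h3; lra.
have := P0 j; rewrite !mxE ler0z floor_ge0 pmulr_rge0//.
Qed.

End volume_sandwich.

(** If a row were tight on the whole polytope, it would annihilate a family of differences of full
    rank and hence be zero. So each inequality is strict somewhere, and successive midpoints make
    all of them strict at once. *)
Lemma strict_point (R : realType) m n (A : 'M[R]_(m, n)) (b : 'cV[R]_m) :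
  affine_dim (Ppoly A b) n -> (forall i, exists j, A i j != 0) ->
  exists2 x, Ppoly A b x & forall i, (A *m x) i 0 < b i 0.
Proof.
move=> [[x0 Px0] [[k [X [XD Xn]]] _]] A0.
have strict1 i : exists2 x, Ppoly A b x & (A *m x) i 0 < b i 0.
  apply: contrapT => nx.
  have eqb x : Ppoly A b x -> (A *m x) i 0 = b i 0.
    move=> Px; apply/eqP; rewrite eq_le Px.1 leNgt; apply/negP => h.
    by apply: nx; exists x.
  have /row_fullP[Y YX] : row_full X by rewrite /row_full Xn.
  have rA : (row i A)^T = 0.
    rewrite -[LHS]mul1mx -YX -mulmxA (_ : X *m _ = 0) ?mulmx0//.
    apply/row_matrixP => a; rewrite row0 row_mul.
    have [x [y [Px [Py ->]]]] := XD a.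
    rewrite -trmx_mul mulmxBr -!row_mul; apply/matrixP => p q.
    rewrite (ord1 p) (ord1 q); move: (eqb _ Px) (eqb _ Py); rewrite !mxE => ex ey.
    by apply/eqP; rewrite subr_eq0; apply/eqP; exact: etrans ex (esym ey).
  have [j /eqP] := A0 i; apply.
  by have /matrixP/(_ j 0) := rA; rewrite !mxE.
have [x Px xs] : exists2 x, Ppoly A b x & forall i, i \in enum 'I_m -> (A *m x) i 0 < b i 0.
  elim: (enum 'I_m) => [|i s [x Px xs]]; first by exists x0.
  have [y Py yi] := strict1 i.
  have lin l : (A *m (2^-1 *: (x + y))) l 0 = 2^-1 * ((A *m x) l 0 + (A *m y) l 0).
    by rewrite -scalemxAr mulmxDr !mxE.
  exists (2^-1 *: (x + y)).
    split => [l|j]; first by rewrite lin; have := Px.1 l; have := Py.1 l; lra.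
    by rewrite !mxE; have := Px.2 j; have := Py.2 j; lra.
  move=> l; rewrite inE lin => /predU1P[->|/xs h]; first by have := Px.1 i; lra.
  by have := Py.1 l; lra.
by exists x => // i; apply: xs; rewrite mem_enum.
Qed.

Lemma dilated_interior_point (R : realType) m n (A : 'M[R]_(m, n)) (b : 'cV[int]_m) (C : int) :
  totally_unimodular A -> affine_dim (Ppoly A (intmx b)) n ->
  (forall i, exists j, A i j != 0) ->
  exists (j : nat) (z : 'cV[int]_n), (0 < j)%N /\
    int_points A (intmx (j%:Z *: b + const_mx (- C))) z.
Proof.
move=> TUA dimP A0; have [x [_ x0] xs] := strict_point dimP A0.
pose e i := intmx b i 0 - (A *m x) i 0.
have e0 i : 0 < e i by rewrite subr_gt0.
pose L : R := `|C%:~R| + n%:R.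
have L0 : 0 <= L by rewrite addr_ge0.
(* Dilating by [j.+1] raises every slack [e i] to at least [L], enough for the depth [C] plus the
   rounding error [n]. *)
pose j := Num.trunc (\sum_i L / e i).
have je i : L <= j.+1%:R * e i.
  rewrite -ler_pdivrMr//; apply: le_trans (ltW (truncnS_gt _)).
  rewrite (bigD1 i)//= lerDl sumr_ge0// => l _.
  by rewrite divr_ge0// ltW.
exists j.+1, (map_mx Num.floor (j.+1%:R *: x)); split=> //; split=> [i|l]; last first.
  by rewrite !mxE ler0z floor_ge0 mulr_ge0.
have := floor_row (j.+1%:R *: x) i TUA; rewrite ler_norml => /andP[+ _].
rewrite -scalemxAr [X in X - _]mxE => h.
have := je i; rewrite /e mulrBr => h2.
rewrite [leRHS]mxE [X in _ <= X%:~R]mxE [X in _ <= (X + _)%:~R]mxE [X in _ <= (_ + X)%:~R]mxE.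
rewrite intrD intrM intrN -pmulrn (ord1 ord0).
by move: h2; rewrite [intmx b i 0]mxE; have := ler_norm (C%:~R : R); rewrite /L; lra.
Qed.

(** Otherwise [p - q] would have degree [n] and a positive leading coefficient, hence would be
    positive far out. *)
Lemma coef_le_eventually (R : realType) (n : nat) (p q : {poly R}) (K : nat) :
  (size p <= n.+1)%N -> (size q <= n.+1)%N ->
  (forall k : nat, (K <= k)%N -> p.[k%:R] <= q.[k%:R]) -> p`_n <= q`_n.
Proof.
move=> sp sq pq; rewrite leNgt; apply/negP => qp.
have cn : 0 < (p - q)`_n by rewrite coefB subr_gt0.
have sn : size (p - q) = n.+1.
  apply/eqP; rewrite eqn_leq (leq_trans (size_polyD _ _)) ?geq_max ?size_polyN ?sp//=.
  by rewrite ltnNge; apply/negP => /leq_sizeP/(_ n (leqnn n)) h; rewrite h ltxx in cn.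
have lc : lead_coef (p - q) = (p - q)`_n by rewrite lead_coefE sn.
rewrite -lc in cn; have [M HM] := poly_pinfty_gt_lc cn.
pose k := maxn K (Num.trunc M).+1.
have := HM k%:R; rewrite hornerD hornerN.
have -> : M <= k%:R.
  by apply: le_trans (ltW (truncnS_gt M)) _; rewrite ler_nat leq_maxr.
by have := pq k (leq_maxl _ _) => h /(_ isT); lra.
Qed.

Lemma coef_sandwich (R : realType) (n j K : nat) (f : {poly R}) (V : R) :
  (size f <= n.+1)%N ->
  (forall k : nat, (K <= k)%N -> V * (k%:R - j%:R) ^+ n <= f.[k%:R] <= V * (k%:R + j%:R) ^+ n) ->
  f`_n = V.
Proof.
move=> sf fV.
have main (c : R) : let q := V *: ('X - c%:P) ^+ n in
  [/\ (size q <= n.+1)%N, q`_n = V & forall x, q.[x] = V * (x - c) ^+ n].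
  have sq : size (('X - c%:P) ^+ n) = n.+1 by rewrite size_exp_XsubC.
  split.
  - by rewrite (leq_trans (size_scale_leq _ _)) ?sq.
  - have : lead_coef (('X - c%:P) ^+ n) = 1 by apply/eqP/monic_exp/monicXsubC.
    by rewrite lead_coefE sq coefZ => /= ->; rewrite mulr1.
  - by move=> x; rewrite hornerZ horner_exp !hornerE.
apply/eqP; rewrite eq_le; apply/andP; split.
- have [sq qn qE] := main (- j%:R).
  rewrite -[leRHS]qn; apply: (@coef_le_eventually _ _ _ _ K) => // k kK.
  by rewrite qE opprK; have /andP[] := fV k kK.
- have [sq qn qE] := main j%:R.
  rewrite -[leLHS]qn; apply: (@coef_le_eventually _ _ _ _ K) => // k kK.
  by rewrite qE; have /andP[] := fV k kK.
Qed.

Lemma int_points_sub (R : realType) m n (A : 'M[R]_(m, n)) (b b' : 'cV[int]_m) z :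
  (forall i, b i 0 <= b' i 0) -> int_points A (intmx b) z -> int_points A (intmx b') z.
Proof.
move=> bb' [zA z0]; split=> // i; apply: le_trans (zA i) _.
by rewrite !mxE ler_int.
Qed.

Lemma int_pointsD (R : realType) m n (A : 'M[R]_(m, n)) (b b' : 'cV[int]_m) z z' :
  int_points A (intmx b) z -> int_points A (intmx b') z' ->
  int_points A (intmx (b + b')) (z + z').
Proof.
move=> [zA z0] [zA' z0']; split=> i.
  rewrite !map_mxD mulmxDr mxE [leRHS]mxE; exact: lerD.
by rewrite map_mxD mxE; exact: addr_ge0.
Qed.

Lemma int_pointsMn (R : realType) m n (A : 'M[R]_(m, n)) (b : 'cV[int]_m) z t :
  int_points A (intmx b) z -> int_points A (intmx (b *+ t)) (z *+ t).
Proof.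
move=> zP; elim: t => [|t IH]; last by rewrite !mulrS; exact: int_pointsD.
split=> i; last by rewrite !mxE.
by rewrite !mulr0n !map_mx0 mulmx0 !mxE.
Qed.

Lemma volume_squeeze (R : realType) m n (A : 'M[R]_(m, n)) (b c : 'cV[int]_m) :
  totally_unimodular A -> bounded_set (Ppoly A (intmx b)) ->
  affine_dim (Ppoly A (intmx b)) n -> (forall i, exists j, A i j != 0) ->
  exists (V : R) (j K : nat), [/\ volume (Ppoly A (intmx b)) = V%:E, 0 < V &
    forall k : nat, (K <= k)%N ->
      V * (k%:R - j%:R) ^+ n <= (Npts A (intmx (k%:Z *: b + c)))%:R <= V * (k%:R + j%:R) ^+ n].
Proof.
move=> TUA bd dimP A0.
(* At least [n], to absorb the rounding error in the volume bounds, and at least every [|c i 0|], to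
   place the count for [c] between those for [- C] and [C]. *)
pose C : int := n%:Z + \sum_i `|c i 0|.
have Cc i : `|c i 0| <= C.
  by rewrite /C (bigD1 i)//= addrCA lerDl addr_ge0// sumr_ge0.
have nC : n%:Z <= C by rewrite lerDl sumr_ge0.
have C0 : 0 <= C by apply: le_trans nC.
have [Km Hm] := int_points_boxed (const_mx (- C)) bd.
have [Kp Hp] := int_points_boxed (const_mx C) bd.
have [Kc Hc] := int_points_boxed c bd.
(* Depth [C + C]: translation by [z0] turns the right-hand side [k b + C] into [(k + j) b - C]. *)
have [j [z0 [j0 z0P]]] := dilated_interior_point (C + C) TUA dimP A0.
pose K := (absz Km + absz Kp + absz Kc).+1.
pose Sm (k : nat) := int_points A (intmx (k%:Z *: b + const_mx (- C))).
pose Sp (k : nat) := int_points A (intmx (k%:Z *: b + const_mx C)).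
pose Sc (k : nat) := int_points A (intmx (k%:Z *: b + c)).
have fm k : (K <= k)%N -> finite_set (Sm k).
  by move=> kK; have [|B SB] := Hm k%:Z; [lia|exact: finite_box SB].
have fp k : (K <= k)%N -> finite_set (Sp k).
  by move=> kK; have [|B SB] := Hp k%:Z; [lia|exact: finite_box SB].
have fc k : (K <= k)%N -> finite_set (Sc k).
  by move=> kK; have [|B SB] := Hc k%:Z; [lia|exact: finite_box SB].
pose N (S : nat -> set 'cV[int]_n) k : nat := #|` fset_set (S k)|%fset.
have mc k : (K <= k)%N -> (N Sm k <= N Sc k)%N.
  move=> kK; apply: (@leq_card_injection _ _ _ id) => //; [exact: fm|exact: fc|].
  by move=> z; apply: int_points_sub => i; rewrite !mxE lerD2l; have := Cc i; rewrite ler_norml => /andP[].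
have cp k : (K <= k)%N -> (N Sc k <= N Sp k)%N.
  move=> kK; apply: (@leq_card_injection _ _ _ id) => //; [exact: fc|exact: fp|].
  by move=> z; apply: int_points_sub => i; rewrite !mxE lerD2l; have := Cc i; rewrite ler_norml => /andP[].
have pm k : (K <= k)%N -> (N Sp k <= N Sm (k + j))%N.
  move=> kK; apply: (@leq_card_injection _ _ _ (fun z => z + z0)).
  - exact: addIr.
  - exact: fp.
  - by apply: fm; lia.
  - move=> z Sz; have := int_pointsD Sz z0P; apply: int_points_sub => i.
    by rewrite !mxE; move: (b i 0) (C) => b' C'; rewrite PoszD; lia.
have kge k : (K <= k)%N -> (0 < k)%N by exact: leq_ltn_trans.
have lo k : (K <= k)%N ->
    ((k%:R ^- n * (N Sm k)%:R)%:E <= volume (Ppoly A (intmx b)))%E.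
  move=> kK; have [|B SB] := Hm k%:Z; first by lia.
  by apply: (volume_ge TUA nC (kge _ kK) SB).
have up k : (K <= k)%N ->
    (volume (Ppoly A (intmx b)) <= (k%:R ^- n * (N Sp k)%:R)%:E)%E.
  move=> kK; have [|B SB] := Hp k%:Z; first by lia.
  by apply: (volume_le TUA nC (kge _ kK) SB).
have [V VE] : exists V, volume (Ppoly A (intmx b)) = V%:E.
  have := lo K (leqnn K); have := up K (leqnn K).
  by case: (volume _) => // V _ _; exists V.
have kn0 k : (K <= k)%N -> 0 < (k%:R : R) ^+ n.
  by move=> /kge k0; rewrite exprn_gt0// ltr0n.
have loV k : (K <= k)%N -> (N Sm k)%:R <= V * k%:R ^+ n.
  by move=> kK; have := lo k kK; rewrite VE lee_fin mulrC ler_pdivrMr// kn0.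
have upV k : (K <= k)%N -> V * k%:R ^+ n <= (N Sp k)%:R.
  by move=> kK; have := up k kK; rewrite VE lee_fin [_^-1 * _]mulrC ler_pdivlMr// kn0.
exists V, j, (K + j)%N; split=> // [|k kK].
  (* Positivity of [V] needs a point in some [Sm k]. The multiple [z0 *+ K] has right-hand side
     [K (j b - 2 C)], at most [K j b - C] because [K >= 1] and [C >= 0]. *)
  pose k := (K * j)%N.
  have kK : (K <= k)%N by rewrite leq_pmulr.
  have Nk : (0 < N Sm k)%N.
    rewrite cardfs_gt0; apply/fset0Pn; exists (z0 *+ K).
    rewrite in_fset_set; last exact: fm.
    apply/mem_set; have := int_pointsMn K z0P; apply: int_points_sub => i.
    rewrite !mxE mulmxnE !mxE -mulr_natr /k PoszM natz /K.
    by move: (b i 0) => b'; move: C0; move: (C) => C'; nia.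
  have := loV k kK; rewrite -(ltr0n R) in Nk => h.
  by rewrite -(pmulr_lgt0 _ (kn0 k kK)); exact: lt_le_trans Nk h.
have kK' : (K <= k)%N by lia.
have kj : (K <= k - j)%N by lia.
(* The chains are [V (k - j)^n <= N Sp (k - j) <= N Sm k <= N Sc k] and [N Sc k <= N Sp k <= N Sm (k
   + j) <= V (k + j)^n]; the threshold [K + j] keeps [k - j] above [K]. *)
apply/andP; split.
  rewrite -natrB; last by lia.
  apply: le_trans (upV _ kj) _; rewrite ler_nat.
  apply: leq_trans (pm _ kj) _; rewrite subnK; last by lia.
  exact: mc.
rewrite -natrD; apply: le_trans (loV _ (leq_trans kK' (leq_addr _ _))).
by rewrite ler_nat; apply: leq_trans (cp _ kK') (pm _ kK').
Qed.

Theorem theorem26 (R : realType) (m n : nat) (A : 'M[R]_(m, n))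
    (b c : 'cV[int]_m) :
  totally_unimodular A ->
  bounded_set (Ppoly A (map_mx (fun a : int => a%:~R) b)) ->
  exists f : {poly R},
    (size f <= n.+1)%N /\
    (exists K : int, forall k : int, K <= k ->
       let bk := map_mx (fun a : int => a%:~R) (k *: b + c) in
       finite_set (int_points A bk) /\
       (Npts A bk)%:R = f.[k%:~R]) /\
    (affine_dim (Ppoly A (map_mx (fun a : int => a%:~R) b)) n ->
     (forall i : 'I_m, exists j : 'I_n, A i j != 0) ->
     size f = n.+1 /\
     ((lead_coef f)%:E = volume (Ppoly A (map_mx (fun a : int => a%:~R) b)))%E).
Proof.
move=> TUA bd; have [A1 AE TUA1] := TU_int TUA.
have [M [M' [K HK]]] := int_points_bounded c bd.
have [f sf [K1 fE]] := Npts_poly AE TUA1 HK.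
have [K2 HK2] := int_points_boxed c bd.
exists f; split=> //; split.
  exists (Num.max K1 K2) => k; rewrite ge_max => /andP[k1 k2] /=; split; last exact: fE.
  by have [B SB] := HK2 k k2; exact: finite_box SB.
move=> dimP A0; have [V [j [K3 [VE V0 HV]]]] := volume_squeeze c TUA bd dimP A0.
have fn : f`_n = V.
  apply: (@coef_sandwich _ _ j (K3 + absz K1)) sf _ => k kK.
  have -> : f.[k%:R] = (Npts A (intmx (k%:Z *: b + c)))%:R by rewrite fE//; lia.
  by apply: HV; lia.
have sn : size f = n.+1.
  apply/eqP; rewrite eqn_leq sf /= ltnNge; apply/negP => /leq_sizeP/(_ n (leqnn n)) h.
  by rewrite -fn h ltxx in V0.
by split=> //; rewrite lead_coefE sn fn VE.
Qed.
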